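(* Let $G$ be a group acting on a local dendrite $X$ which is not a dendrite, and let $M$ be a minimal set of $G$. Then $M$ is either a finite orbit, or a Cantor set, or a circle.
   Context: A continuum is a compact connected metric space. A circle is a space homeomorphic to the unit circle $S^1$. A dendrite is a locally connected continuum containing no circle. A local dendrite is a continuum every point of which has a neighborhood which is a dendrite. $G$ is a discrete group; an action of $G$ on a compact metric space $X$ is a continuous map $G\times X\to X$, $(g,x)\mapsto g(x)$, with $e(x)=x$ and $(g_1g_2)(x)=g_1(g_2(x))$ (so each $g\in G$ acts as a homeomorphism of $X$). The orbit of $x$ is $G(x)=\{g(x): g\in G\}$. A subset $A\subset X$ is $G$-invariant if $g(A)=A$ for all $g\in G$. A minimal set of $G$ is a non-empty, closed, $G$-invariant subset of $X$ which is minimal, with respect to inclusion, for these properties. *)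

(* Defs.v *)
From HB Require Import structures.
From mathcomp Require Import all_boot all_order all_algebra.
From mathcomp Require Import all_classical all_reals all_analysis.

Set Implicit Arguments.
Unset Strict Implicit.
Unset Printing Implicit Defensive.

Import Order.TTheory GRing.Theory Num.Theory.
Import numFieldNormedType.Exports.

Local Open Scope classical_set_scope.
Local Open Scope ring_scope.

Definition homeomorphic (S T : topologicalType) : Prop :=
  exists (f : S -> T) (g : T -> S),
    [/\ continuous f, continuous g, cancel f g & cancel g f].

Definition unit_circle (R : realType) : set (R * R) :=
  [set p | p.1 ^+ 2 + p.2 ^+ 2 = 1].
Arguments unit_circle R : clear implicits.

(* Subsets [A : set T] used as types carry the topology induced by [T]. *)
Definition is_circle (R : realType) (T : topologicalType) (A : set T) : Prop :=
  homeomorphic A (unit_circle R).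

Definition is_cantor_set (T : topologicalType) (A : set T) : Prop :=
  homeomorphic A cantor_space.

(* [V `&` A] ranges over the open sets of the subspace [A]; [connected] only
   depends on the induced topology. *)
Definition locally_connected (T : topologicalType) (A : set T) : Prop :=
  forall x, A x -> forall U, nbhs x U ->
    exists V, [/\ open V, V x, V `&` A `<=` U & connected (V `&` A)].

(* Metric spaces occurring below are subsets of an ambient metric space [X],
   with the restricted metric; [[set: X]] stands for [X] itself. *)
Definition continuum (R : realType) (X : metricType R) (A : set X) : Prop :=
  compact A /\ connected A.

Definition dendrite (R : realType) (X : metricType R) (A : set X) : Prop :=
  [/\ continuum A, locally_connected A &
      ~ exists2 C : set X, C `<=` A & is_circle R C].

Definition local_dendrite (R : realType) (X : metricType R) : Prop :=
  continuum [set: X] /\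
  forall x : X, exists2 V : set X, nbhs x V & dendrite V.

Section GroupAction.
Context {G : groupType} {X : topologicalType}.

Definition is_group_action (act : G -> X -> X) : Prop :=
  [/\ continuous (fun p : discrete_topology G * X => act p.1 p.2),
      forall x, act 1%g x = x &
      forall g h x, act (g * h)%g x = act g (act h x)].

Definition orbit_of (act : G -> X -> X) (x : X) : set X :=
  [set act g x | g in [set: G]].

Definition invariant_set (act : G -> X -> X) (A : set X) : Prop :=
  forall g, act g @` A = A.

Definition minimal_set (act : G -> X -> X) (M : set X) : Prop :=
  [/\ M !=set0, closed M, invariant_set act M &
      forall N : set X, N !=set0 -> closed N -> invariant_set act N ->
        N `<=` M -> N = M].

End GroupAction.

(* Main.v *)
Require Import Defs.
From HB Require Import structures.
From mathcomp Require Import all_boot all_order all_algebra.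
From mathcomp Require Import all_classical all_reals all_analysis.
From mathcomp Require Import finmap ring lra.

Set Implicit Arguments.
Unset Strict Implicit.
Unset Printing Implicit Defensive.

Import Order.TTheory GRing.Theory Num.Theory.
Import numFieldNormedType.Exports.

Local Open Scope classical_set_scope.
Local Open Scope ring_scope.

(** Call a set nondegenerate if it has two distinct points.  A minimal set M
    with an isolated point is a finite orbit, and a perfect minimal set without
    nondegenerate connected subsets is a Cantor set (minimal_isolated and
    cantor_setP).  So let K be a nondegenerate connected subset of M.  Since X
    is a locally connected continuum and not a dendrite, it contains a circle.
    One has to show that M is a circle.

    The topological input is the following (circle_of_nonseparating): if an
    interior point a of an arc does not separate the endpoints of the arc in a
    locally connected compact space E, then a lies on a circle in E.  Indeed the
    component of the endpoints in the complement of a is an open connected set,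
    in which they are joined by a second arc (arc_in_open); the two arcs contain
    a circle through a (theta_circle).  To construct arcs, one obtains paths as
    limits of finer and finer chains of points (linked_path) and removes a
    maximal family of loops from them (path_contains_arc).

    Consequently a dendrite is uniquely arcwise connected and has arbitrarily
    small neighbourhoods with finite boundary.  By compactness X contains only
    finitely many circles, each of them composed of finitely many segments from
    a finite list (finite_circles).

    The elements of the group that preserve every circle therefore form a normal
    subgroup of finite index, and M is a finite disjoint union of translates of
    a minimal set N of this subgroup, where N may be chosen to contain K
    (minimal_reduction).

    The set N meets a circle (minimal_meets_circle).  Otherwise an arc near a
    point of K shows that some point a of N separates two points of N, so that
    one of these is cut off by a from a given circle L.  But to be cut off from
    L is a strict order with open upper sets, invariant under the subgroup; on a
    compact minimal set such an order is trivial (minimal_no_cuts).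

    A circle that meets N contains N by minimality, and equals N because N
    contains one of its arcs (minimal_in_circle).  Finally N is then the only
    circle in X (minimal_circle_unique): a circle elsewhere would be connected
    to N through a component W of the complement of N, and either the points of
    N that are limits of W form a proper invariant closed subset, or W supplies
    a bypass between two points of N and thereby another circle that meets N.
    So all translates of N are equal to N, and M = N is a circle. *)

(** * Compactness, connectedness and homeomorphisms *)

(** A nonempty space can be pointed on the fly, which gives access to the
    equivalence of compactness with the finite subcover property. *)
Lemma compact_seq_cover (T : topologicalType) (A : set T) (I : choiceType)
    (D : set I) (f : I -> set T) :
  compact A -> (forall i, D i -> open (f i)) -> A `<=` \bigcup_(i in D) f i ->
  exists s : seq I, (forall i, i \in s -> D i) /\
    forall x, A x -> exists2 i, i \in s & f i x.
Proof.
have [->|/set0P[x _]] := eqVneq A set0; first by move=> _ _ _; exists [::].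
pose T' : ptopologicalType := HB.pack T (isPointed.Build T x).
move=> cA oD AD; have {}cA : @cover_compact T' A by rewrite -compact_cover.
have [D' sD Ac] := cA I D f oD AD.
exists (enum_fset D'); split=> [i iD'|y /Ac[i /= iD' fy]].
  exact: (set_mem (sD i iD')).
by exists i.
Qed.

(** This is what local connectedness of a subspace is used for: the
    components of a relatively open set are again relatively open, so that
    they are domains to which the arc theorem below applies. *)
Lemma component_open (T : topologicalType) (E O : set T) (x : T) :
  locally_connected E -> open O ->
  exists2 U, open U & connected_component (E `&` O) x = E `&` U.
Proof.
move=> lc oO; set C := connected_component _ _.
exists (\bigcup_(V in [set V | open V /\ V `&` E `<=` C]) V).
  by apply: bigcup_open => V [].
apply/seteqP; split=> [y Cy|y [Ey [V [_ VC] Vy]]]; last exact: VC.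
have [Ey Oy] : (E `&` O) y := connected_component_sub Cy.
have [V [oV Vy VO cV]] := lc y Ey O (open_nbhs_nbhs (conj oO Oy)).
split=> //; exists V => //; split=> //.
move=> z Vz; apply: connected_component_trans Cy _.
exists (V `&` E) => //; split=> //.
by move=> w Vw; split; [case: Vw|exact: VO].
Qed.

(** Induction on a connected set: a property that is locally constant
    and holds at one point holds everywhere. Reachability by chains and by
    arcs is proved in this way. *)
Lemma connected_clopen_ind (T : topologicalType) (Q : set T) (P : set T) (x : T) :
  connected Q -> Q x -> P x ->
  (forall y, Q y -> exists2 V, nbhs y V &
     forall z, Q z -> V z -> (P y <-> P z)) ->
  Q `<=` P.
Proof.
move=> cQ Qx Px loc.
suff <- : Q `&` P = Q by move=> y [].
apply: cQ; first by exists x.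
  exists (\bigcup_(V in [set V | open V /\ Q `&` V `<=` P]) V).
    by apply: bigcup_open => V [].
  apply/seteqP; split=> [y [Qy Py]|y [Qy [V [_ VC] Vy]]]; last first.
    by split=> //; apply: VC.
  split=> //; have [V] := loc y Qy.
  rewrite nbhsE => -[W [oW Wy] WV] VP; exists W => //; split=> // z [Qz Wz].
  by apply/(VP z Qz (WV _ Wz)).
exists (~` \bigcup_(V in [set V | open V /\ Q `&` V `<=` ~` P]) V).
  by apply: open_closedC; apply: bigcup_open => V [].
apply/seteqP; split=> [y [Qy Py]|y [Qy Cy]].
  by split=> // -[V [_ VP] Vy]; apply: (VP y).
split=> //; apply: contrapT => nPy; apply: Cy.
have [V] := loc y Qy.
rewrite nbhsE => -[W [oW Wy] WV] VP; exists W => //; split=> // z [Qz Wz] Pz.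
by apply: nPy; apply/(VP z Qz (WV _ Wz)).
Qed.

Section homeo.
Context {S T : topologicalType}.

Lemma within_continuous_closedP (A : set S) (g : S -> T) :
  (forall D, closed D -> closed (A `&` g @^-1` D)) -> {within A, continuous g}.
Proof.
move=> cg; apply/continuous_closedP => D cD; apply/closed_subspaceP.
by exists (A `&` g @^-1` D); [exact: cg|rewrite setIAC setIid setIC].
Qed.

Lemma closed_within_preimage (A : set S) (g : S -> T) (D : set T) :
  {within A, continuous g} -> closed A -> closed D -> closed (A `&` g @^-1` D).
Proof.
move=> cg cA cD.
have /closed_subspaceP[V cV VE] :
    closed (g @^-1` D : set (subspace A)) by move/continuous_closedP: cg; apply.
by rewrite setIC -VE; apply: closedI.
Qed.

(** A continuous injection of a compact set is closed, hence its
    inverse is continuous. Circles are produced through this lemma, never by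
    exhibiting an inverse. *)
Lemma homeomorphic_image (K : set S) (g : S -> T) :
  compact K -> hausdorff_space S -> hausdorff_space T ->
  {within K, continuous g} -> {in K &, injective g} ->
  homeomorphic (g @` K) K.
Proof.
move=> cK hS hT cg inj.
have mem (k : K) : (g @` K) (g (\val k)) by exists (\val k) => //; exact: set_valP.
pose G (k : K) : g @` K := exist _ (g (\val k)) (mem_set (mem k)).
have /choice[F FP] : forall y : g @` K, exists x : K, g (\val x) = \val y.
  move=> y; have [x Kx gx] := set_valP y.
  by exists (exist _ x (mem_set Kx)).
have FG : cancel G F.
  by move=> k; apply: val_inj; apply: inj; [exact: valP|exact: valP|rewrite FP].
have GF : cancel F G by move=> y; apply: val_inj; rewrite /= FP.
have ext (U : set K) : open U -> exists2 V, open V & U = \val @^-1` V.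
  by move=> [V oV UV]; exists V.
exists F, G; split=> //.
- apply/continuousP => U /ext[V oV ->].
  have cC : closed (g @` (K `&` ~` V)).
    apply: compact_closed => //; apply: continuous_compact.
      by apply: continuous_subspaceW cg => x [].
    by apply: compact_closedI => //; exact: open_closedC.
  exists (~` (g @` (K `&` ~` V))); first exact: closed_openC.
  apply/seteqP; split=> y /=.
    move=> nC; apply: contrapT => nV; apply: nC; exists (\val (F y)) => //.
    by split=> //; exact: set_valP.
  move=> Vy [x [Kx nV] gx]; apply: nV.
  suff -> : x = \val (F y) by [].
  by apply: inj; [exact: mem_set|exact: valP|rewrite FP].
- apply/continuousP => U [V oV <-].
  have /continuousP/(_ V oV) := (subspace_sigL_continuousP K g).1 cg.
  by congr (open _); apply/seteqP; split.
Qed.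
End homeo.

(** * Arcs *)

Section real_aux.
Context {R : realType}.

Lemma closed_has_min (S : set R) (l : R) : closed S -> S !=set0 ->
  (forall t, S t -> l <= t) -> exists2 m, S m & forall t, S t -> m <= t.
Proof.
move=> cS S0 lS; have iS : has_inf S by split=> //; exists l.
have lb t : S t -> inf S <= t by move=> St; apply: ge_inf => //; exists l.
exists (inf S) => //; apply: contrapT => nS.
have : nbhs (inf S) (~` S).
  by apply: open_nbhs_nbhs; split=> //; exact: closed_openC.
move=> /nbhs_ballP[e /= e0 be].
have [t St te] := inf_adherent e0 iS.
apply: (be t) => //; rewrite -ball_normE /=.
rewrite ltr_norml; have := lb t St; lra.
Qed.

Lemma closed_has_max (S : set R) (l : R) : closed S -> S !=set0 ->
  (forall t, S t -> t <= l) -> exists2 m, S m & forall t, S t -> t <= m.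
Proof.
move=> cS S0 Sl; have [|||m Sm mP] := @closed_has_min (-%R @^-1` S) (- l).
- by apply: (continuous_closedP _).1 cS; exact: opp_continuous.
- by case: S0 => t St; exists (- t); rewrite /= opprK.
- by move=> t /Sl; lra.
by exists (- m) => // t St; have := mP (- t); rewrite /= opprK => /(_ St); lra.
Qed.
End real_aux.

Section arcs.
Context {R : realType} {X : metricType R}.
Implicit Types (p q r x y : X) (A B F : set X).

(** The parametrisation is continuous on the whole line and only its
    restriction to [a, b] matters; this keeps continuity proofs free of
    subspace topologies. The segment is arbitrary, so that restricting and
    reversing arcs need no rescaling. The endpoints are part of the predicate
    because arcs are always combined along them. *)
Definition is_arc p q A := exists (a b : R) (f : R -> X),
  [/\ a < b, continuous f, {in `[a, b] &, injective f},
      f a = p /\ f b = q & f @` `[a, b] = A].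

Lemma continuous_paste (f g : R -> X) (b : R) :
  continuous f -> continuous g -> f b = g b ->
  continuous (fun t => if t <= b then f t else g t).
Proof.
move=> cf cg fgb; apply/continuous_closedP => D cD.
rewrite (_ : _ @^-1` _ = ([set t | t <= b] `&` f @^-1` D) `|`
                        ([set t | b <= t] `&` g @^-1` D)).
  apply: closedU; apply: closedI.
  - exact: closed_le.
  - exact: (continuous_closedP _).1.
  - exact: closed_ge.
  - exact: (continuous_closedP _).1.
apply/seteqP; split=> t /=.
  by case: (leP t b) => [tb Dt|/ltW tb Dt]; [left|right].
move=> [[tb Dt]|[bt Dt]]; first by rewrite tb.
case: (leP t b) => // tb; rewrite (_ : t = b) ?fgb; last by apply/le_anti/andP.
by rewrite (_ : b = t) //; apply/le_anti/andP.
Qed.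

Lemma arcI (a b : R) (f : R -> X) : a < b -> continuous f ->
  {in `[a, b] &, injective f} -> is_arc (f a) (f b) (f @` `[a, b]).
Proof. by move=> ab cf inj; exists a, b, f. Qed.

Lemma arc_param p q A (c d : R) : is_arc p q A -> c < d ->
  exists f : R -> X, [/\ continuous f, {in `[c, d] &, injective f},
    f c = p, f d = q & f @` `[c, d] = A].
Proof.
move=> [a [b [f [ab cf inj [<- <-] <-]]]] cd.
have dc : 0 < d - c by rewrite subr_gt0.
have ba : 0 < b - a by rewrite subr_gt0.
pose h t := a + (t - c) * ((b - a) / (d - c)).
have k0 : 0 < (b - a) / (d - c) by rewrite divr_gt0.
have hc : h c = a by rewrite /h subrr mul0r addr0.
have hd : h d = b by rewrite /h mulrC divfK ?gt_eqF// addrC subrK.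
have hle s t : (h s <= h t) = (s <= t) by rewrite lerD2l ler_pM2r// lerD2r.
have hI t : t \in `[c, d] -> h t \in `[a, b].
  by rewrite !in_itv /= => /andP[ct td]; rewrite -{1}hc -hd !hle ct.
have ch : continuous h.
  move=> t; apply: cvgD; first exact: cvg_cst.
  by apply: cvgMl; apply: cvgB; [exact: cvg_id|exact: cvg_cst].
exists (f \o h); split; rewrite /= ?hc ?hd//.
- by move=> t; apply: continuous_comp; [exact: ch|exact: cf].
- move=> s t /hI hs /hI ht /(inj _ _ hs ht) hst.
  by apply/le_anti; rewrite -(hle s t) -(hle t s) hst lexx.
- apply/seteqP; split=> [_ [t tI <-]|_ [t tI <-]]; first by exists (h t) => //; apply: hI.
  pose s := c + (t - a) * ((d - c) / (b - a)).
  have hs : h s = t.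
    by rewrite /h /s; field; rewrite !gt_eqF.
  exists s => /=; last by rewrite hs.
  move: tI; rewrite /= !in_itv /= => /andP[at_ tb].
  by rewrite -(hle c) -(hle s) hs hc hd at_.
Qed.

Lemma arc_sym p q A : is_arc p q A -> is_arc q p A.
Proof.
move=> [a [b [f [ab cf inj [<- <-] <-]]]].
exists (- b), (- a), (f \o -%R); split; rewrite /= ?opprK//.
- by rewrite ltrN2.
- by move=> t; apply: continuous_comp; [exact: opp_continuous|exact: cf].
- move=> s t; rewrite !in_itv /= => s1 t1 /inj st; apply: oppr_inj; apply: st;
  rewrite !in_itv /=; lra.
- apply/seteqP; split=> [_ [t /=+ <-]|_ [t /= + <-]]; rewrite in_itv /= => tI.
    by exists (- t) => //=; rewrite in_itv /=; lra.
  by exists (- t) => //=; rewrite ?opprK// in_itv /=; lra.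
Qed.

Lemma arc_neq p q A : is_arc p q A -> p <> q.
Proof.
move=> [a [b [f [ab cf inj [<- <-] _]]]] fab.
have := inj _ _ _ _ fab; rewrite !in_itv /= !lexx (ltW ab) => /(_ isT isT) E.
by move: ab; rewrite E ltxx.
Qed.

Lemma arc_left p q A : is_arc p q A -> A p.
Proof.
move=> [a [b [f [ab cf inj [<- _] <-]]]]; exists a => //=.
by rewrite in_itv /= lexx ltW.
Qed.

Lemma arc_right p q A : is_arc p q A -> A q.
Proof. by move=> /arc_sym/arc_left. Qed.

Lemma arc_compact p q A : is_arc p q A -> compact A.
Proof.
move=> [a [b [f [ab cf inj [_ _] <-]]]].
apply: continuous_compact; first exact: continuous_subspaceT.
exact: segment_compact.
Qed.

Lemma arc_closed p q A : is_arc p q A -> closed A.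
Proof. by move=> /arc_compact; apply: compact_closed; exact: metric_hausdorff. Qed.

Lemma arc_connected p q A : is_arc p q A -> connected A.
Proof.
move=> [a [b [f [ab cf inj [_ _] <-]]]].
apply: connected_continuous_connected; last exact: continuous_subspaceT.
exact: segment_connected.
Qed.

Lemma arc_open_connected p q A : is_arc p q A -> connected (A `\ q).
Proof.
move=> [a [b [f [ab cf inj [_ <-] <-]]]].
rewrite (_ : _ `\ _ = f @` `[a, b[).
  apply: connected_continuous_connected; last exact: continuous_subspaceT.
  exact/connected_intervalP/interval_is_interval.
apply/seteqP; split=> [_ [[t tI <-] /= tb]|_ [t tI <-]].
  exists t => //; move: tI; rewrite /= !in_itv /= => /andP[-> /=].
  by rewrite le_eqVlt => /predU1P[tE|//]; rewrite tE in tb.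
move: tI; rewrite /= !in_itv /= => /andP[at_ tb]; split.
  by exists t => //=; rewrite in_itv /= at_ ltW.
move=> /= /inj; rewrite !in_itv /= at_ lexx !ltW// => /(_ isT isT) E.
by move: tb; rewrite E ltxx.
Qed.

Lemma arc_split p q A x : is_arc p q A -> A x -> x <> p -> x <> q ->
  exists B C, [/\ is_arc p x B, is_arc x q C, B `|` C = A & B `&` C = [set x]].
Proof.
move=> [a [b [f [ab cf inj [<- <-] <-]]]] [s /= sI <-] sa sb.
have as_ : a < s.
  move: sI; rewrite in_itv /= => /andP[+ _]; rewrite le_eqVlt => /predU1P[E|//].
  by rewrite E in sa.
have sb_ : s < b.
  move: sI; rewrite in_itv /= => /andP[_ +]; rewrite le_eqVlt => /predU1P[E|//].
  by rewrite E in sb.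
have I1 t : t \in `[a, s] -> t \in `[a, b] by rewrite !in_itv /=; lra.
have I2 t : t \in `[s, b] -> t \in `[a, b] by rewrite !in_itv /=; lra.
exists (f @` `[a, s]), (f @` `[s, b]); split.
- by apply: arcI => // u v /I1 ? /I1 ?; apply: inj.
- by apply: arcI => // u v /I2 ? /I2 ?; apply: inj.
- apply/seteqP; split=> [_ [[t /I1 tI <-]|[t /I2 tI <-]]|_ [t tI <-]].
  + by exists t.
  + by exists t.
  + case: (leP t s) => ts; [left|right]; exists t => //; move: tI; rewrite /= !in_itv /=; lra.
- apply/seteqP; split=> [_ [[t tI <-] [u uI /inj E]]|_ -> /=]; last first.
    by split; exists s => //=; rewrite in_itv /= lexx ltW.
  have tu : u = t by apply: E; [exact: I2|exact: I1].
  rewrite tu in uI *; congr f.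
  by move: tI uI; rewrite /= !in_itv /=; lra.
Qed.

Lemma arc_sub p q A x y : is_arc p q A -> A x -> A y -> x <> y ->
  exists2 B, is_arc x y B & B `<=` A.
Proof.
move=> [a [b [f [ab cf inj [_ _] <-]]]].
suff H s t : s \in `[a, b] -> t \in `[a, b] -> s < t ->
    exists2 B, is_arc (f s) (f t) B & B `<=` f @` `[a, b].
  move=> [s sI <-] [t tI <-]; have [st|ts|->//] := ltgtP s t => _.
    exact: H.
  by have [B /arc_sym ? ?] := H t s tI sI ts; exists B.
move=> sI tI st; exists (f @` `[s, t]).
  by apply: arcI => // u v uI vI; apply: inj; move: uI vI sI tI; rewrite !in_itv /=; lra.
by move=> _ [u uI <-]; exists u => //; move: uI sI tI; rewrite /= !in_itv /=; lra.
Qed.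

Lemma arc_first p q A F : is_arc p q A -> closed F -> A `&` F !=set0 -> ~ F p ->
  exists x B, [/\ is_arc p x B, B `<=` A & B `&` F = [set x]].
Proof.
move=> [a [b [f [ab cf inj [<- _] <-]]]] cF [_ [[t tI <-] Ft]] nFp.
have cS : closed (`[a, b] `&` f @^-1` F).
  apply: closedI; first exact: interval_closed.
  exact: (continuous_closedP _).1.
have [||s [sI Fs] sm] := closed_has_min (l := a) cS.
- by exists t.
- by move=> u [+ _]; rewrite /= in_itv /= => /andP[].
have as_ : a < s.
  move: sI; rewrite /= in_itv /= => /andP[+ _]; rewrite le_eqVlt => /predU1P[E|//].
  by rewrite /= -E in Fs.
have I1 u : u \in `[a, s] -> u \in `[a, b].
  by move: sI; rewrite /= !in_itv /=; lra.
exists (f s), (f @` `[a, s]); split.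
- by apply: arcI => // u v /I1 ? /I1 ?; apply: inj.
- by move=> _ [u /I1 uI <-]; exists u.
- apply/seteqP; split=> [_ [[u uI <-] Fu]|_ -> /=].
    congr f; have := sm u (conj (I1 _ uI) Fu); move: uI; rewrite /= in_itv /=; lra.
  by split=> //; exists s => //=; rewrite in_itv /= lexx ltW.
Qed.

Lemma arc_cat p q r A B : is_arc p q A -> is_arc q r B -> A `&` B = [set q] ->
  is_arc p r (A `|` B).
Proof.
move=> aA aB AB.
have [f [cf fi <- fq fA]] := arc_param aA ltr01.
have [|g [cg gi gq <- gB]] := @arc_param _ _ _ 1 2 aB; first lra.
pose h t := if t <= 1 then f t else g t.
have ch : continuous h by apply: continuous_paste; rewrite ?fq.
have hf t : t <= 1 -> h t = f t by rewrite /h => ->.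
have hg t : 1 <= t -> h t = g t.
  rewrite /h; case: (leP t 1) => // t1 t2.
  have -> : t = 1 by lra.
  by rewrite fq gq.
have <- : h 0 = f 0 by rewrite hf.
have <- : h 2 = g 2 by rewrite hg//; lra.
rewrite (_ : A `|` B = h @` `[0, 2]); last first.
  rewrite -fA -gB; apply/seteqP; split=> [_ [[t /= + <-]|[t /= + <-]]|_ [t /= + <-]];
    rewrite in_itv /= => tI.
  - by exists t; [rewrite /= in_itv /=; lra|rewrite hf//; lra].
  - by exists t; [rewrite /= in_itv /=; lra|rewrite hg//; lra].
  - case: (leP t 1) => t1; [left|right]; exists t.
    + by rewrite /= in_itv /=; lra.
    + by rewrite hf.
    + by rewrite /= in_itv /=; lra.
    + by rewrite hg ?ltW.
apply: arcI => //.
have key s t : s \in `[0, 1] -> t \in `[1, 2] -> f s = g t -> s = t.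
  move=> sI tI E.
  have fs : (A `&` B) (f s) by split; [rewrite -fA|rewrite -gB E]; [exists s|exists t].
  rewrite AB /= in fs.
  have -> : s = 1 by apply: fi; rewrite ?fs// in_itv /= ler01 lexx.
  apply: gi => //; first by rewrite in_itv /= lexx; lra.
  by rewrite gq -E.
move=> s t; rewrite !in_itv /= => sI tI.
case: (leP s 1) => s1; case: (leP t 1) => t1.
- by rewrite !hf//; apply: fi; rewrite in_itv /=; lra.
- by rewrite hf// hg ?ltW//; apply: key; rewrite in_itv /=; lra.
- rewrite hg ?ltW// hf// => /esym E; apply/esym; move: E.
  by apply: key; rewrite in_itv /=; lra.
- by rewrite !hg ?ltW//; apply: gi; rewrite in_itv /=; lra.
Qed.

(** Two arcs with a common endpoint may intersect wildly; the first one
    is left at its first point on the second one, which is then followed to its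
    end. *)
Lemma arc_trans x y z A B : is_arc x y A -> is_arc y z B -> x <> z ->
  exists2 C, is_arc x z C & C `<=` A `|` B.
Proof.
move=> aA aB xz.
have [Bx|nBx] := pselect (B x).
  have [C aC CB] := arc_sub aB Bx (arc_right aB) xz.
  by exists C => // w /CB; right.
have [|w [A1 [a1 A1A A1B]]] := arc_first aA (arc_closed aB) _ nBx.
  by exists y; split; [exact: arc_right aA|exact: arc_left aB].
have [Bw A1w] : B w /\ A1 w by have : [set w] w by []; rewrite -A1B => -[].
have [wz|wz] := pselect (w = z).
  by rewrite -wz; exists A1 => // v /A1A; left.
have [B1 b1 B1B] := arc_sub aB Bw (arc_right aB) wz.
exists (A1 `|` B1); last by move=> v [/A1A|/B1B]; [left|right].
apply: (arc_cat a1 b1); apply/seteqP; split=> [v [Av /B1B Bv]|_ -> /=].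
  by rewrite -A1B.
by split=> //; exact: arc_left b1.
Qed.

Lemma arc_inner p q A : is_arc p q A -> exists x, [/\ A x, x <> p & x <> q].
Proof.
move=> [a [b [f [ab cf inj [<- <-] <-]]]]; exists (f ((a + b) / 2)).
have I : (a + b) / 2 \in `[a, b] by rewrite in_itv /=; lra.
split; first by exists ((a + b) / 2).
- by move/inj => /(_ I); rewrite in_itv /= lexx ltW// => /(_ isT); lra.
- by move/inj => /(_ I); rewrite in_itv /= lexx ltW// => /(_ isT); lra.
Qed.

End arcs.

(** * Circles as unions of two arcs *)

Section circle_glue.
Context {R : realType} {X : metricType R}.

Lemma unit_circle_closed : closed (unit_circle R).
Proof.
pose h (p : R * R) := p.1 * p.1 + p.2 * p.2.
have -> : unit_circle R = h @^-1` [set 1].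
  by apply/seteqP; split=> p; rewrite /unit_circle /h /= !expr2.
apply: preimage_closed; last exact: closed_eq.
move=> p _; rewrite /h; apply: cvgD; apply: cvgM;
  solve [exact: cvg_fst | exact: cvg_snd].
Qed.

Lemma unit_circle_compact : compact (unit_circle R).
Proof.
have := @subclosed_compact _ (unit_circle R) (`[-1, 1] `*` `[-1, 1]).
move=> /(_ unit_circle_closed); apply.
  by apply: compact_setX; exact: segment_compact.
move=> [x y]; rewrite /unit_circle /= => E.
by split; rewrite /= in_itv /=; nra.
Qed.

(** The two arcs are parametrised by [-1, 1] and placed on the upper and
    the lower half of the unit circle, a point being sent to the parameter
    given by its first coordinate. *)
Lemma circle_glue (p q : X) (A B : set X) : is_arc p q A -> is_arc p q B ->
  A `&` B = [set p; q] -> is_circle R (A `|` B).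
Proof.
move=> aA aB AB.
have pq := arc_neq aA.
have m11 : -1 < 1 :> R by lra.
have [f [cf fi fp fq fA]] := arc_param aA m11.
have [g [cg gi gp gq gB]] := arc_param aB m11.
pose F (z : R * R) := if 0 <= z.2 then f z.1 else g z.1.
have I (z : R * R) : unit_circle R z -> z.1 \in `[-1, 1].
  by rewrite /unit_circle in_itv /=; nra.
have fgE (s t : R) : s \in `[-1, 1] -> t \in `[-1, 1] -> f s = g t ->
    s = t /\ (s = -1 \/ s = 1).
  move=> sI tI E.
  have : (A `&` B) (f s) by split; [rewrite -fA|rewrite -gB E]; [exists s|exists t].
  rewrite AB => -[] /= E'.
    have s1 : s = -1 by apply: fi; rewrite ?fp// in_itv /= lexx; lra.
    have t1 : t = -1 by apply: gi; rewrite ?gp -?E// in_itv /= lexx; lra.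
    by rewrite s1 t1; split=> //; left.
  have s1 : s = 1 by apply: fi; rewrite ?fq// in_itv /= lexx; lra.
  have t1 : t = 1 by apply: gi; rewrite ?gq -?E// in_itv /= lexx; lra.
  by rewrite s1 t1; split=> //; right.
have -> : A `|` B = F @` unit_circle R.
  apply/seteqP; split.
    have S (t : R) : t \in `[-1, 1] -> 0 <= 1 - t ^+ 2 by rewrite in_itv /=; nra.
    rewrite -fA -gB => _ [] [t tI <-]; have tS := S t tI.
      exists (t, Num.sqrt (1 - t ^+ 2)).
        by rewrite /unit_circle /= sqr_sqrtr//; lra.
      by rewrite /F /= sqrtr_ge0.
    exists (t, - Num.sqrt (1 - t ^+ 2)).
      by rewrite /unit_circle /= sqrrN sqr_sqrtr//; lra.
    rewrite /F /= oppr_ge0; case: ifP => // s0.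
    have E : t ^+ 2 = 1.
      have : Num.sqrt (1 - t ^+ 2) = 0 by apply/le_anti; rewrite s0 sqrtr_ge0.
      by move/eqP; rewrite sqrtr_eq0; lra.
    have /orP[/eqP->|/eqP->] : (t == 1) || (t == -1) by rewrite -sqrf_eq1 E.
      by rewrite fq gq.
    by rewrite fp gp.
  move=> _ [z /I zI <-]; rewrite /F; case: ifP => _; [left|right].
    by rewrite -fA; exists z.1.
  by rewrite -gB; exists z.1.
have csnd : continuous (snd : R * R -> R) by move=> z; exact: cvg_snd.
have hge : closed [set z : R * R | 0 <= z.2].
  by have H := (continuous_closedP _).1 csnd [set t : R | 0 <= t]; apply: H; exact: closed_ge.
have hle : closed [set z : R * R | z.2 <= 0].
  by have H := (continuous_closedP _).1 csnd [set t : R | t <= 0]; apply: H; exact: closed_le.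
have cc (h : R -> X) : continuous h -> continuous (h \o fst : R * R -> X).
  by move=> ch z; apply: continuous_comp; [exact: cvg_fst|exact: ch].
apply: homeomorphic_image.
- exact: unit_circle_compact.
- exact: norm_hausdorff.
- exact: metric_hausdorff.
- apply: within_continuous_closedP => D cD.
  rewrite (_ : _ `&` _ = unit_circle R `&`
     (([set z : R * R | 0 <= z.2] `&` (f \o fst) @^-1` D) `|`
      ([set z : R * R | z.2 <= 0] `&` (g \o fst) @^-1` D))).
    apply: closedI; first exact: unit_circle_closed.
    apply: closedU; apply: closedI.
    + exact: hge.
    + by move/continuous_closedP : (cc f cf); apply.
    + exact: hle.
    + by move/continuous_closedP : (cc g cg); apply.
  apply/seteqP; split=> z [Kz]; rewrite /= /F.
    by case: (leP 0 z.2) => [z0 Dz|/ltW z0 Dz]; split=> //; [left|right].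
  move=> [[z0 Dz]|[z0 Dz]]; split=> //; rewrite /= /F; first by rewrite z0.
  case: ifP => // z0'.
  have z20 : z.2 = 0 by apply/le_anti; rewrite z0.
  have E : z.1 ^+ 2 = 1 by move: Kz; rewrite /unit_circle /= z20 expr0n addr0.
  have /orP[/eqP E1|/eqP E1] : (z.1 == 1) || (z.1 == -1) by rewrite -sqrf_eq1 E.
    by rewrite /= E1 fq -gq -E1.
  by rewrite /= E1 fp -gp -E1.
- move=> [x1 y1] [x2 y2] /set_mem K1 /set_mem K2; rewrite /F /=.
  have I1 := I _ K1; have I2 := I _ K2; move: K1 K2 I1 I2; rewrite /unit_circle /=.
  move=> K1 K2 I1 I2.
  have sq x y y' : x ^+ 2 + y ^+ 2 = 1 -> x ^+ 2 + y' ^+ 2 = 1 ->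
      0 <= y * y' -> y = y' :> R.
    move=> E1 E2 yy'.
    have : y ^+ 2 = y' ^+ 2 by lra.
    by move/eqP; rewrite eqf_sqr => /orP[/eqP//|/eqP E]; nra.
  have key x y y' : x ^+ 2 + y ^+ 2 = 1 -> x ^+ 2 + y' ^+ 2 = 1 ->
      x = -1 \/ x = 1 -> y = y' :> R.
    move=> E1 E2 xE; have xx : x ^+ 2 = 1 by case: xE => ->; rewrite ?sqrrN expr1n.
    have /eqP : y ^+ 2 = 0 by lra.
    have /eqP : y' ^+ 2 = 0 by lra.
    by rewrite !sqrf_eq0 => /eqP -> /eqP ->.
  case: (leP 0 y1) => h1; case: (leP 0 y2) => h2.
  + move/fi => /(_ I1 I2) E; rewrite -{}E in K2 *; congr pair.
    by apply: sq K1 K2 _; nra.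
  + by move/fgE => /(_ I1 I2)[E /key e]; rewrite -{}E in K2 *; congr pair; apply: e.
  + move/esym/fgE => /(_ I2 I1)[E /key e]; rewrite {}E in K2 e *; congr pair.
    exact: e.
  + move/gi => /(_ I1 I2) E; rewrite -{}E in K2 *; congr pair.
    by apply: sq K1 K2 _; nra.
Qed.

End circle_glue.

Section circle_split.
Context {R : realType}.

(** The squaring map of complex numbers divided by the squared modulus.
    It identifies the projective line with the unit circle; segments of
    vectors are thereby sent to arcs of the circle, and no angle is needed. *)
Definition nsqr (v : R * R) : R * R :=
  ((v.1 ^+ 2 - v.2 ^+ 2) / (v.1 ^+ 2 + v.2 ^+ 2),
   (v.1 * v.2 *+ 2) / (v.1 ^+ 2 + v.2 ^+ 2)).

Definition cross (v w : R * R) : R := v.1 * w.2 - v.2 * w.1.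

Lemma norm2_gt0 (v : R * R) : v != 0 -> 0 < v.1 ^+ 2 + v.2 ^+ 2.
Proof.
case: v => x y /= nz; rewrite lt_neqAle addr_ge0 ?sqr_ge0// andbT eq_sym.
apply: contra nz; rewrite paddr_eq0 ?sqr_ge0// !sqrf_eq0.
by move=> /andP[/eqP-> /eqP->].
Qed.

Lemma nsqr_circle v : v != 0 -> unit_circle R (nsqr v).
Proof.
move=> /norm2_gt0; case: v => x y /= n0; rewrite /unit_circle /nsqr /=.
by field; rewrite gt_eqF.
Qed.

(** The square root of a point c + i s of the circle is proportional to
    (1 + c) + i s, except for the point -1. *)
Lemma nsqr_surj P : unit_circle R P -> exists2 v, v != 0 & nsqr v = P.
Proof.
case: P => c s; rewrite /unit_circle /= => E.
have [c1|c1] := eqVneq c (-1).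
  exists (0, 1); first by rewrite xpair_eqE oner_eq0 andbF.
  rewrite /nsqr /= c1; have /eqP : s ^+ 2 = 0 by rewrite c1 in E; lra.
  by rewrite sqrf_eq0 => /eqP ->; congr pair; field.
have c0 : 1 + c != 0 by apply: contra c1 => /eqP ?; apply/eqP; lra.
exists (1 + c, s); first by rewrite xpair_eqE (negPf c0).
have n0 : (1 + c) ^+ 2 + s ^+ 2 = (1 + c) * 2 by rewrite sqrrD; lra.
rewrite /nsqr /= n0; congr pair.
  have -> : (1 + c) ^+ 2 - s ^+ 2 = c * ((1 + c) * 2) by rewrite sqrrD; lra.
  by rewrite mulfK// mulf_neq0.
have -> : (1 + c) * s *+ 2 = s * ((1 + c) * 2) by ring.
by rewrite mulfK// mulf_neq0.
Qed.

Lemma nsqr_par v w : v != 0 -> w != 0 -> (nsqr v == nsqr w) = (cross v w == 0).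
Proof.
move=> /norm2_gt0 + /norm2_gt0; case: v => x y; case: w => z t; rewrite /nsqr /cross /=.
set n := _ + _; set m := _ + _ => n0 m0.
have n1 : n != 0 by rewrite gt_eqF.
have m1 : m != 0 by rewrite gt_eqF.
apply/eqP/eqP => [[E1 E2]|E].
  have e1 : (x ^+ 2 - y ^+ 2) * m = (z ^+ 2 - t ^+ 2) * n.
    by move/eqP : E1; rewrite eqr_div// => /eqP.
  have e2 : (x * y *+ 2) * m = (z * t *+ 2) * n.
    by move/eqP : E2; rewrite eqr_div// => /eqP.
  have : (x * t - y * z) ^+ 2 * (2 * (n * m)) = 0.
    rewrite /n /m in e1 e2 *.
    have -> : (x * t - y * z) ^+ 2 * (2 * ((x ^+ 2 + y ^+ 2) * (z ^+ 2 + t ^+ 2))) =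
      ((x ^+ 2 + y ^+ 2) * (z ^+ 2 + t ^+ 2))^+2
      - ((x ^+ 2 - y ^+ 2) * (z ^+ 2 + t ^+ 2)) * ((z ^+ 2 - t ^+ 2) * (x ^+ 2 + y ^+ 2))
      - (x * y *+ 2 * (z ^+ 2 + t ^+ 2)) * (z * t *+ 2 * (x ^+ 2 + y ^+ 2)) by ring.
    by rewrite e1 e2; ring.
  move/eqP; rewrite mulf_eq0 sqrf_eq0 => /orP[/eqP//|].
  by rewrite gt_eqF// mulr_gt0// mulr_gt0.
congr pair; apply/eqP; rewrite eqr_div//; apply/eqP; rewrite /n /m.
  have : (x ^+ 2 - y ^+ 2) * (z ^+ 2 + t ^+ 2) - (z ^+ 2 - t ^+ 2) * (x ^+ 2 + y ^+ 2) =
    2 * (x * t - y * z) * (x * t + y * z) by ring.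
  by rewrite E mulr0 mul0r => /subr0_eq.
have : (x * y *+ 2) * (z ^+ 2 + t ^+ 2) - (z * t *+ 2) * (x ^+ 2 + y ^+ 2) =
    2 * (x * t - y * z) * (y * t - x * z) by ring.
by rewrite E mulr0 mul0r => /subr0_eq.
Qed.

Lemma nsqr_continuous (T : topologicalType) (f : T -> R * R) :
  continuous f -> (forall t, f t != 0) -> continuous (nsqr \o f).
Proof.
move=> cf nz t; have /norm2_gt0 n0 := nz t.
have c1 : continuous (fun t => (f t).1).
  by move=> u; apply: continuous_comp; [exact: cf|exact: cvg_fst].
have c2 : continuous (fun t => (f t).2).
  by move=> u; apply: continuous_comp; [exact: cf|exact: cvg_snd].
have cn : (fun t => (f t).1 ^+ 2 + (f t).2 ^+ 2) @ t --> (f t).1 ^+ 2 + (f t).2 ^+ 2.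
  by apply: cvgD; rewrite expr2; under eq_fun do rewrite expr2; apply: cvgM; first [exact: c1|exact: c2].
have cV : (fun t => ((f t).1 ^+ 2 + (f t).2 ^+ 2)^-1) @ t -->
    ((f t).1 ^+ 2 + (f t).2 ^+ 2)^-1.
  by apply: cvgV cn; rewrite gt_eqF.
have cx : (fun t => ((f t).1 ^+ 2 - (f t).2 ^+ 2) / ((f t).1 ^+ 2 + (f t).2 ^+ 2))
    @ t --> (nsqr (f t)).1.
  apply: cvgM cV; apply: cvgB; rewrite expr2; under eq_fun do rewrite expr2;
    by apply: cvgM; first [exact: c1|exact: c2].
have cy : (fun t => ((f t).1 * (f t).2 *+ 2) / ((f t).1 ^+ 2 + (f t).2 ^+ 2))
    @ t --> (nsqr (f t)).2.
  apply: cvgM cV; rewrite mulr2n; under eq_fun do rewrite mulr2n.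
  by apply: cvgD; apply: cvgM; first [exact: c1|exact: c2].
exact: (cvg_pair cx cy).
Qed.


(** If a and b are square roots of the two given points, the two arcs are
    the images under squaring of the segments from a to b and from a to -b:
    every vector is proportional to a vector of exactly one of them, apart
    from the endpoints. *)
Lemma circle_split (X : metricType R) (C : set X) (p q : X) :
  is_circle R C -> C p -> C q -> p <> q ->
  exists A B, [/\ is_arc p q A, is_arc p q B, A `|` B = C & A `&` B = [set p; q]].
Proof.
move=> [F [G [cF cG FG GF]]] Cp Cq pq.
pose p' : C := exist _ p (mem_set Cp).
pose q' : C := exist _ q (mem_set Cq).
have [a a0 aE] := nsqr_surj (set_valP (F p')).
have [b b0 bE] := nsqr_surj (set_valP (F q')).
pose D := cross a b.
have D0 : D != 0.
  rewrite -nsqr_par// aE bE; apply/eqP => /val_inj/(can_inj FG).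
  by move=> /(congr1 (fun c : C => \val c)).
pose l (e u : R) : R * R :=
  ((1 - u) * a.1 + e * (u * b.1), (1 - u) * a.2 + e * (u * b.2)).
have la e u : cross a (l e u) = e * u * D by rewrite /cross /l /D /cross /=; ring.
have lb e u : cross (l e u) b = (1 - u) * D by rewrite /cross /l /D /cross /=; ring.
have l0 e u : e != 0 -> l e u != 0.
  have c0l w : cross 0 w = 0 by rewrite /cross /= !mul0r subrr.
  have c0r w : cross w 0 = 0 by rewrite /cross /= !mulr0 subrr.
  move=> e0; apply/eqP => lE; have := la e u; have := lb e u; rewrite lE c0l c0r.
  move/esym/eqP; rewrite mulf_eq0 (negPf D0) orbF subr_eq0 => /eqP <-.
  by rewrite mulr1 => /esym/eqP; rewrite mulf_eq0 (negPf D0) (negPf e0).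
have cl e : continuous (l e).
  have c1 (x y : R) : continuous (fun u : R => (1 - u) * x + e * (u * y)).
    move=> u; apply: cvgD.
      by apply: cvgMl; apply: cvgB; [exact: cvg_cst|exact: cvg_id].
    by apply: cvgMr; apply: cvgMl; exact: cvg_id.
  by move=> u; exact: (cvg_pair (c1 a.1 b.1 u) (c1 a.2 b.2 u)).
pose s e (e0 : e != 0) u : unit_circle R :=
  exist _ (nsqr (l e u)) (mem_set (nsqr_circle (l0 e u e0))).
have cs e (e0 : e != 0) : continuous (s e e0).
  apply: continuous_comp_initial.
  exact: (nsqr_continuous (cl e) (fun u => l0 e u e0)).
pose f e (e0 : e != 0) u : X := \val (G (s e e0 u)).
have cf e (e0 : e != 0) : continuous (f e e0).
  have cG' : continuous ((\val : C -> X) \o G).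
    move=> c; apply: continuous_comp; first exact: cG.
    exact: initial_continuous.
  move=> u; exact: (@continuous_comp _ _ _ (s e e0) ((\val : C -> X) \o G) u
    (cs e e0 u) (cG' _)).
have fE e d (e0 : e != 0) (d0 : d != 0) u v :
    (f e e0 u == f d d0 v) = (cross (l e u) (l d v) == 0).
  rewrite -nsqr_par ?l0//; apply/eqP/eqP => [/val_inj/(can_inj GF)|E].
    by move/(congr1 (fun c : unit_circle R => \val c)).
  by congr (\val (G _)); apply: val_inj.
have crossl e d u v : cross (l e u) (l d v) = (d * (1 - u) * v - e * u * (1 - v)) * D.
  by rewrite /cross /l /D /cross /=; ring.
have f0 e (e0 : e != 0) : f e e0 0 = p.
  rewrite /f (_ : s e e0 0 = F p') ?FG//; apply: val_inj => /=.
  by rewrite -aE; congr nsqr; rewrite /l !subr0 !mul1r !mul0r !mulr0 !addr0 -surjective_pairing.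
have f1 e (e0 : e != 0) : f e e0 1 = q.
  rewrite /f (_ : s e e0 1 = F q') ?FG//; apply: val_inj => /=.
  rewrite -bE; apply/eqP; rewrite nsqr_par ?l0//; apply/eqP.
  by rewrite lb subrr mul0r.
have fA e (e0 : e != 0) : is_arc p q (f e e0 @` `[0, 1]).
  rewrite -(f0 e e0) -[in X in is_arc _ X](f1 e e0); apply: arcI => //.
  move=> u v; rewrite !in_itv /= => u01 v01 /eqP; rewrite fE crossl.
  rewrite mulf_eq0 (negPf D0) orbF => /eqP E.
  have : e * (v - u) = 0 by rewrite -E; ring.
  by move/eqP; rewrite mulf_eq0 (negPf e0) /= subr_eq0 => /eqP.
have m10 : -1 != 0 :> R by rewrite oppr_eq0 oner_eq0.
exists (f 1 (oner_neq0 R) @` `[0, 1]), (f (-1) m10 @` `[0, 1]); split=> //.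
  apply/seteqP; split=> [_ [[u _ <-]|[u _ <-]]|c Cc]; rewrite /f.
  - exact: set_valP.
  - exact: set_valP.
  pose c' : C := exist _ c (mem_set Cc).
  have [z z0 zE] := nsqr_surj (set_valP (F c')).
  pose x := cross z a; pose y := cross z b.
  have zl e u : cross (l e u) z = - ((1 - u) * x + e * u * y).
    by rewrite /cross /l /x /y /cross /=; ring.
  have cE e (e0 : e != 0) u : (1 - u) * x + e * u * y = 0 -> f e e0 u = c.
    move=> E; rewrite /f (_ : s e e0 u = F c') ?FG//; apply: val_inj => /=.
    by rewrite -zE; apply/eqP; rewrite nsqr_par ?l0// zl E oppr0.
  have [x0|x0] := eqVneq x 0.
    left; exists 0; first by rewrite /= in_itv /= lexx ler01.
    by apply: cE; rewrite x0; ring.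
  have ratio (t : R) : 0 <= t -> x / (x + x * t) \in `[0, 1].
    by move=> t0; rewrite -{2}[x]mulr1 -mulrDr invfM mulrA divff// mul1r in_itv /=
      invr_ge0 addr_ge0//= invf_le1 ?lerDl// ltr_pwDl.
  have [xy|xy] := leP (x * y) 0.
    left; exists (x / (x + x * (- (y / x)))).
      apply: ratio; rewrite -mulrN -invrN.
      by rewrite (_ : y / - x = - (x * y) / (x ^+ 2)) ?divr_ge0 ?sqr_ge0 ?oppr_ge0//; field.
    have h : x + x * (- (y / x)) != 0.
      apply/eqP => h.
      have h2 : x * x = x * y by move: h; rewrite mulrN mulrCA divff// mulr1 => /subr0_eq <-.
      by move: xy; rewrite -h2 -expr2 leNgt exprn_even_gt0//= x0.
    by apply: cE; field; rewrite x0 /=; move: h; rewrite mulrN mulrCA divff// mulr1.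
  right; exists (x / (x + x * (y / x))).
    apply: ratio.
    by rewrite (_ : y / x = (x * y) / (x ^+ 2)) ?divr_ge0 ?sqr_ge0// ?ltW//; field.
  have h : x + x * (y / x) != 0.
    apply/eqP => h; move: h; rewrite mulrCA divff// mulr1 => h.
    have h2 : y = - x by rewrite -[LHS]addr0 -[in LHS]oppr0 -h; ring.
    by move: xy; rewrite h2 mulrN -expr2 oppr_gt0 ltNge sqr_ge0.
  by apply: cE; field; rewrite x0 /=; move: h; rewrite mulrCA divff// mulr1.
apply/seteqP; split; last first.
  move=> _ [|] -> /=.
    by split; [exists 0 => //|exists 0 => //]; rewrite /= in_itv /= lexx ler01.
  by split; [exists 1 => //|exists 1 => //]; rewrite /= in_itv /= lexx ler01.
move=> _ [[u /= + <-] [v /= + /eqP]]; rewrite !in_itv /= => u01 v01.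
rewrite eq_sym fE crossl mulf_eq0 (negPf D0) orbF => /eqP E.
have [E0 E1] : (1 - u) * v = 0 /\ u * (1 - v) = 0 by nra.
move/eqP: E0; rewrite mulf_eq0 subr_eq0 => /orP[/eqP<-|/eqP v0].
  by right; rewrite f1.
by left; move: E1; rewrite v0 subr0 mulr1 => ->; rewrite f0.
Qed.

End circle_split.

(** * Theta curves and subcontinua of circles *)

Section theta.
Context {R : realType} {X : metricType R}.
Implicit Types (p q a : X) (A B C K : set X).

(** Follow the first arc from a in both directions until it meets the
    second one: the two pieces, together with the part of the second arc
    between the two points so reached, form a circle. *)
Lemma theta_circle p q a A B : is_arc p q A -> A a -> a <> p -> a <> q ->
  is_arc p q B -> ~ B a -> exists C, [/\ is_circle R C, C a & C `<=` A `|` B].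
Proof.
move=> aA Aa ap aq aB nBa.
have [A1 [A2 [a1 a2 A12 A1A2]]] := arc_split aA Aa ap aq.
have cB := arc_closed aB.
have [|x1 [D1 [d1 D1A D1B]]] := arc_first (arc_sym a1) cB _ nBa.
  by exists p; split; [exact: arc_left a1|exact: arc_left aB].
have [|x2 [D2 [d2 D2A D2B]]] := arc_first a2 cB _ nBa.
  by exists q; split; [exact: arc_right a2|exact: arc_right aB].
have [Dx1 Bx1] : (D1 `&` B) x1 by rewrite D1B.
have [Dx2 Bx2] : (D2 `&` B) x2 by rewrite D2B.
have x12 : x1 <> x2.
  move=> x12; have : (A1 `&` A2) x1 by split; [exact: D1A|rewrite x12; exact: D2A].
  by rewrite A1A2 => /= E; rewrite -E in nBa.
have [B' b' B'B] := arc_sub aB Bx1 Bx2 x12.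
have d1b : is_arc a x2 (D1 `|` B').
  apply: (arc_cat d1 b'); apply/seteqP; split=> [y [Dy /B'B By]|_ ->].
    by rewrite -D1B.
  by split=> //; exact: arc_left b'.
exists ((D1 `|` B') `|` D2); split.
- apply: (circle_glue d1b d2); apply/seteqP; split.
    move=> y [[D1y|/B'B By] D2y].
      by left; have : (A1 `&` A2) y by [split; [exact: D1A|exact: D2A]]; rewrite A1A2.
    by right; have : (D2 `&` B) y by []; rewrite D2B.
  move=> y [|] ->; split.
  + by left; exact: arc_left d1.
  + exact: arc_left d2.
  + by right; exact: arc_right b'.
  + by [].
- by left; left; exact: arc_left d1.
- rewrite -A12 => y [[/D1A|/B'B]|/D2A]; first by left; left.
    by right.
  by left; right.
Qed.

(** Removing one point from each of the two arcs of a circle disconnects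
    p from q. *)
Lemma connected_sub_circle p q A B K : is_arc p q A -> is_arc p q B ->
  A `&` B = [set p; q] -> connected K -> K `<=` A `|` B -> K p -> K q ->
  A `<=` K \/ B `<=` K.
Proof.
move=> aA aB AB cK KAB Kp Kq; apply: contrapT => /not_orP[nA nB].
have /existsNP[a /not_implyP[Aa nKa]] := nA.
have /existsNP[b /not_implyP[Bb nKb]] := nB.
have [||A1 [A2 [a1 a2 A12 A1A2]]] := arc_split aA Aa; do ?by move=> E; rewrite E in nKa.
have [||B1 [B2 [b1 b2 B12 B1B2]]] := arc_split aB Bb; do ?by move=> E; rewrite E in nKb.
have nA1q : ~ A1 q.
  move=> A1q; have : (A1 `&` A2) q by split=> //; exact: arc_right a2.
  by rewrite A1A2 => /= E; rewrite -E in nKa.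
have nA2p : ~ A2 p.
  move=> A2p; have : (A1 `&` A2) p by split=> //; exact: arc_left a1.
  by rewrite A1A2 => /= E; rewrite -E in nKa.
have nB1q : ~ B1 q.
  move=> B1q; have : (B1 `&` B2) q by split=> //; exact: arc_right b2.
  by rewrite B1B2 => /= E; rewrite -E in nKb.
have nB2p : ~ B2 p.
  move=> B2p; have : (B1 `&` B2) p by split=> //; exact: arc_left b1.
  by rewrite B1B2 => /= E; rewrite -E in nKb.
have dis y : K y -> (A1 `|` B1) y -> (A2 `|` B2) y -> False.
  have AB' z : A z -> B z -> z = p \/ z = q.
    by move=> Az Bz; have : (A `&` B) z by []; rewrite AB.
  move=> Ky [] Y1 [] Y2.
  - have : (A1 `&` A2) y by []; rewrite A1A2 => /= E.
    by rewrite E in Ky.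
  - have [] := AB' y; first by rewrite -A12; left.
    + by rewrite -B12; right.
    + by move=> E; rewrite E in Y2.
    + by move=> E; rewrite E in Y1.
  - have [] := AB' y; first by rewrite -A12; right.
    + by rewrite -B12; left.
    + by move=> E; rewrite E in Y2.
    + by move=> E; rewrite E in Y1.
  - have : (B1 `&` B2) y by []; rewrite B1B2 => /= E.
    by rewrite E in Ky.
have cov y : K y -> (A1 `|` B1) y \/ (A2 `|` B2) y.
  move=> /KAB; rewrite -A12 -B12 => -[[]|[]] ?; do ?by left; left.
  - by right; left.
  - by left; right.
  - by right; right.
suff E : K `&` (A1 `|` B1) = K by have := Kq; rewrite -E => -[_ []].
apply: cK.
- by exists p; split=> //; left; exact: arc_left a1.
- exists (~` (A2 `|` B2)).
    apply: closed_openC; apply: closedU; [exact: arc_closed a2|exact: arc_closed b2].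
  apply/seteqP; split=> y [Ky Y]; split=> //; first by move/(dis y Ky Y).
  by case: (cov y Ky).
- exists (A1 `|` B1) => //.
  by apply: closedU; [exact: arc_closed a1|exact: arc_closed b1].
Qed.

Lemma circle_two_points C : is_circle R C -> exists x y, [/\ C x, C y & x <> y].
Proof.
move=> [F [G [_ _ FG GF]]].
have u1 : unit_circle R (1, 0) by rewrite /unit_circle /=; ring.
have u2 : unit_circle R (-1, 0) by rewrite /unit_circle /=; ring.
pose e1 : unit_circle R := exist _ (_, _) (mem_set u1).
pose e2 : unit_circle R := exist _ (_, _) (mem_set u2).
exists (\val (G e1)), (\val (G e2)); split; [exact: set_valP|exact: set_valP|].
move=> /val_inj/(can_inj GF)/(congr1 (fun c : unit_circle R => (\val c).1)) /=; lra.
Qed.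

Lemma circle_closed C : is_circle R C -> closed C.
Proof.
move=> cC; have [x [y [Cx Cy xy]]] := circle_two_points cC.
have [A [B [aA aB <- _]]] := circle_split cC Cx Cy xy.
by apply: closedU; [exact: arc_closed aA|exact: arc_closed aB].
Qed.

Lemma circle_connected C : is_circle R C -> connected C.
Proof.
move=> cC; have [x [y [Cx Cy xy]]] := circle_two_points cC.
have [A [B [aA aB <- _]]] := circle_split cC Cx Cy xy.
apply: connectedU; [|exact: arc_connected aA|exact: arc_connected aB].
by exists x; split; [exact: arc_left aA|exact: arc_left aB].
Qed.

(** If c were a point of D outside C, both arcs of C between two of its
    points would contain the arc of D between these points that misses c. *)
Lemma circle_sub_circle (C D : set X) : is_circle R C -> is_circle R D ->
  C `<=` D -> C = D.
Proof.
move=> cC cD CD; apply/seteqP; split=> // c Dc; apply: contrapT => nCc.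
have [x [y [Cx Cy xy]]] := circle_two_points cC.
have [A [B [aA aB AB AIB]]] := circle_split cD (CD _ Cx) (CD _ Cy) xy.
have [A1 [B1 [aA1 aB1 AB1 AIB1]]] := circle_split cC Cx Cy xy.
have key (K : set X) A' B' : is_arc x y A' -> is_arc x y B' -> A' `|` B' = D ->
    A' `&` B' = [set x; y] -> A' c -> is_arc x y K -> K `<=` C -> B' `<=` K.
  move=> a' b' AB' AIB' A'c aK KC.
  have [|A'K|//] := connected_sub_circle a' b' AIB' (arc_connected aK) _
      (arc_left aK) (arc_right aK).
    by rewrite AB' => z /KC/CD.
  by case: nCc; apply: KC; apply: A'K.
have fin (B' : set X) : is_arc x y B' -> B' `<=` A1 -> B' `<=` B1 -> False.
  move=> aB' BA BB; have [z [Bz zx zy]] := arc_inner aB'.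
  have : (A1 `&` B1) z by split; [exact: BA|exact: BB].
  by rewrite AIB1 => -[].
have A1C : A1 `<=` C by rewrite -AB1; exact: subsetUl.
have B1C : B1 `<=` C by rewrite -AB1; exact: subsetUr.
have : (A `|` B) c by rewrite AB.
move=> [Ac|Bc].
  by apply: (fin _ aB); apply: (key _ _ _ aA aB AB AIB Ac).
have BA : B `|` A = D by rewrite setUC.
have BIA : B `&` A = [set x; y] by rewrite setIC.
by apply: (fin _ aA); apply: (key _ _ _ aB aA BA BIA Bc).
Qed.

End theta.

(** * Arcs in paths *)

Section weighted_sum.
Context {R : realType}.

(** The functional is the sum of u n / 2 ^ (n + 1), the supremum of its
    partial sums. It turns a countable family of monotone functions into one
    that increases as soon as one of them does, and the third property
    preserves equicontinuity. *)
Lemma weighted_sum : exists L : (nat -> R) -> R, forall u v : nat -> R,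
  (forall n, 0 <= u n <= 1) -> (forall n, 0 <= v n <= 1) ->
  [/\ (forall n, u n <= v n) -> L u <= L v,
      (forall n, u n <= v n) -> forall n, u n < v n -> L u < L v &
      forall e, 0 <= e -> (forall n, v n <= u n + e) -> L v <= L u + e].
Proof.
pose S (u : nat -> R) k := \sum_(i < k) u i * 2^-1 ^+ i.+1.
have p0 i : 0 < 2^-1 ^+ i.+1 :> R by rewrite exprn_gt0// invr_gt0.
have geo k : \sum_(i < k) 2^-1 ^+ i.+1 <= 1 :> R.
  suff -> : \sum_(i < k) 2^-1 ^+ i.+1 = 1 - 2^-1 ^+ k :> R.
    by rewrite lerBlDr lerDl exprn_ge0// invr_ge0.
  elim: k => [|k IH]; first by rewrite big_ord0 expr0 subrr.
  by rewrite big_ord_recr /= IH exprS; field.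
have Sbd u : (forall n, 0 <= u n <= 1) -> forall k, S u k <= 1.
  move=> u01 k; apply: le_trans (geo k); apply: ler_sum => i _.
  by have /andP[_ ui] := u01 i; rewrite -[leRHS]mul1r ler_pM2r.
have SL u : (forall n, 0 <= u n <= 1) -> forall k, S u k <= sup (range (S u)).
  move=> u01 k; apply: ub_le_sup; last by exists k.
  by exists 1 => _ [j _ <-]; exact: Sbd.
have LS u x : (forall k, S u k <= x) -> sup (range (S u)) <= x.
  by move=> Sx; apply: ge_sup; [exists (S u 0%N), 0%N|move=> _ [k _ <-]].
have Smon u : (forall n, 0 <= u n <= 1) -> forall j k, (j <= k)%N -> S u j <= S u k.
  move=> u01 j k /subnK <-; elim: (k - j)%N => [|n IH]; first by rewrite add0n.
  rewrite addSn; apply: le_trans IH _; rewrite /S big_ord_recr /= lerDl.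
  by rewrite mulr_ge0 ?(ltW (p0 _))//; have /andP[] := u01 (n + j)%N.
exists (fun u => sup (range (S u))) => u v u01 v01; split.
- move=> uv; apply: LS => k; apply: le_trans (SL v v01 k).
  by apply: ler_sum => i _; rewrite ler_pM2r.
- move=> uv n uvn.
  have d0 : 0 < (v n - u n) * 2^-1 ^+ n.+1 by rewrite mulr_gt0// subr_gt0.
  apply: (@lt_le_trans _ _ (sup (range (S u)) + (v n - u n) * 2^-1 ^+ n.+1)).
    by rewrite ltrDl.
  rewrite -lerBrDr; apply: LS => k; rewrite lerBrDr.
  apply: le_trans (SL v v01 (k + n.+1)%N).
  apply: (@le_trans _ _ (S u (k + n.+1)%N + (v n - u n) * 2^-1 ^+ n.+1)).
    by rewrite lerD2r; apply: Smon => //; exact: leq_addr.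
  have nk : (n < k + n.+1)%N by rewrite addnS ltnS leq_addl.
  rewrite /S (bigD1 (Ordinal nk)) //= [leRHS](bigD1 (Ordinal nk)) //=.
  rewrite addrAC -mulrDl addrCA subrr addr0 lerD2l.
  by apply: ler_sum => i _; rewrite ler_pM2r.
- move=> e e0 vu; apply: LS => k.
  apply: (@le_trans _ _ (S u k + e)); last by rewrite lerD2r SL.
  apply: (@le_trans _ _ (S u k + e * \sum_(i < k) 2^-1 ^+ i.+1)).
    rewrite mulr_sumr /S -big_split /=; apply: ler_sum => i _.
    by rewrite -mulrDl ler_pM2r.
  by rewrite lerD2l -[leRHS]mulr1 ler_wpM2l.
Qed.

End weighted_sum.

Section path_to_arc.
Context {R : realType} {X : metricType R}.

Lemma mdist_continuous (f : R -> X) (t e : R) : continuous f -> 0 < e ->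
  exists2 d, 0 < d & forall s, `|s - t| < d -> mdist (f t) (f s) < e.
Proof.
move=> cf e0.
have /nbhs_ballP[d /= d0 dP] : nbhs t (f @^-1` ball (f t) e).
  by apply: cf; exact: nbhsx_ballx.
exists d => // s sd; have := dP s; rewrite -ball_normE /= distrC => /(_ sd).
by rewrite ballEmdist.
Qed.

(** The components of U are loops of the path f: skipping them leaves a
    continuous path. *)
Definition loop_gaps (f : R -> X) (U : set R) :=
  forall u v, u < v -> ~ U u -> ~ U v -> (forall t, u < t < v -> U t) -> f u = f v.

(** The compactness argument behind both uses of Zorn's lemma: a finite
    subfamily of a chain of sets has a largest member. *)
Lemma chain_seq_max (T : Type) (F : set (set T)) (s : seq (set T)) B0 :
  total_on F subset -> F B0 -> (forall B, B \in s -> F B) ->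
  exists2 B, F B & forall B', B' \in s -> B' `<=` B.
Proof.
move=> tF FB0; elim: s => [|B s IH] sF; first by exists B0.
have [|D FD DP] := IH; first by move=> B' B's; apply: sF; rewrite inE B's orbT.
have FB : F B by apply: sF; rewrite inE eqxx.
have [BD|DB] := tF _ _ FB FD.
  by exists D => // B'; rewrite inE => /predU1P[->//|/DP].
exists B => // B'; rewrite inE => /predU1P[->//|/DP B'D].
exact: subset_trans DB.
Qed.

(** Zorn's lemma makes U maximal, and then f takes the same value at two
    points outside U only if they are the ends of a loop that has been
    removed, for otherwise the interval between them could be removed too.
    Chains have upper bounds because a gap of the union is, up to its ends, a
    compact interval, hence essentially a gap of a member of the chain. *)
Lemma maximal_gaps (f : R -> X) : continuous f -> exists U : set R, [/\ open U, U `<=` `]0, 1[, loop_gaps f U &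
  forall s t : R, s < t -> 0 <= s -> t <= 1 -> ~ U s -> ~ U t -> f s = f t ->
    forall r : R, s < r < t -> U r].
Proof.
move=> cf; pose P (U : set R) := [/\ open U, U `<=` `]0, 1[ & loop_gaps f U].
have [] := @Zorn_bigcup _ P.
  move=> F FP tF; split.
  - by apply: bigcup_open => U /FP[].
  - by move=> t [U /FP[_ U01 _]] /U01.
  - move=> u v uv nUu nUv UI.
    apply: contrapT => /eqP; rewrite -mdist_gt0 => d0.
    set d := mdist _ _ in d0.
    have d20 : 0 < d / 2 by rewrite divr_gt0.
    have [e1 e10 e1P] := mdist_continuous u cf d20.
    have [e2 e20 e2P] := mdist_continuous v cf d20.
    pose e := Num.min (Num.min e1 e2) (v - u).
    have e0 : 0 < e by rewrite !lt_min e10 e20 subr_gt0.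
    have [ee1 ee2 evu] : [/\ e <= e1, e <= e2 & e <= v - u].
      by rewrite /e !ge_min !lexx !orbT.
    pose u' := u + e / 3; pose v' := v - e / 3.
    have uv' : u' <= v' by rewrite /u' /v'; lra.
    have [s [sF sc]] : exists s : seq (set R), (forall B, B \in s -> F B) /\
        forall x, x \in `[u', v'] -> exists2 B, B \in s & B x.
      have [||s [sF sc]] := compact_seq_cover (@segment_compact _ u' v') (D := F) (f := id).
      - by move=> B /FP[].
      - move=> t /=; rewrite in_itv /= => tI.
        by apply: UI; rewrite /u' /v' in tI; lra.
      by exists s.
    have [B0 B0s B0u] : exists2 B, B \in s & B u' by apply: sc; rewrite in_itv /= lexx.
    have [B FB BP] := chain_seq_max tF (sF _ B0s) sF.
    have [oB _ gB] := FP _ FB.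
    have nBu : ~ B u by move=> Bu; apply: nUu; exists B.
    have nBv : ~ B v by move=> Bv; apply: nUv; exists B.
    have cB : closed (~` B) := open_closedC oB.
    have [|||u1 [nBu1 u1u'] u1P] := @closed_has_max _ (~` B `&` [set t | t <= u']) u'.
    - by apply: closedI => //; exact: closed_le.
    - by exists u; split=> //=; rewrite /u'; lra.
    - by move=> t [].
    have [|||v1 [nBv1 v1v'] v1P] := @closed_has_min _ (~` B `&` [set t | v' <= t]) v'.
    - by apply: closedI => //; exact: closed_ge.
    - by exists v; split=> //=; rewrite /v'; lra.
    - by move=> t [].
    have uu1 : u <= u1 by apply: u1P; split=> //=; rewrite /u'; lra.
    have vv1 : v1 <= v by apply: v1P; split=> //=; rewrite /v'; lra.
    rewrite /= in u1u' v1v'.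
    have inB (t : R) : u1 < t < v1 -> B t.
      move=> /andP[ut tv]; apply: contrapT => nBt.
      have [tu'|tu'] := leP t u'; first by have := u1P t (conj nBt tu'); lra.
      have [tv'|tv'] := leP v' t; first by have := v1P t (conj nBt tv'); lra.
      have [|B1 B1s B1t] := sc t; first by rewrite in_itv /=; lra.
      by apply: nBt; exact: BP B1t.
    (* B has the gap (u1, v1), whose ends are close to u and v *)
    have u1v1 : u1 < v1.
      rewrite lt_neqAle (le_trans u1u') ?(le_trans uv')// andbT.
      apply/eqP => E; apply: nBu1; have -> : u1 = u' by apply/le_anti; rewrite u1u' E (le_trans uv').
      by apply: BP B0u.
    have E := gB _ _ u1v1 nBu1 nBv1 inB.
    have h1 : mdist (f u) (f u1) < d / 2.
      by apply: e1P; rewrite ger0_norm; rewrite /u' in u1u'; lra.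
    have h2 : mdist (f v) (f v1) < d / 2.
      by apply: e2P; rewrite ler0_norm; rewrite /v' in v1v'; lra.
    have := metric_triangle (f u) (f u1) (f v).
    by rewrite E in h1 *; rewrite metric_sym in h2; rewrite -/d; lra.
move=> U [[oU U01 gU] Umax]; exists U; split=> // s t st s0 t1 nUs nUt fst r rI.
apply: contrapT => nUr.
apply: (Umax (U `|` `]s, t[)).
  split; first by move=> x; left.
  by move=> /(_ r) UU; apply: nUr; apply: UU; right; rewrite /= in_itv.
split.
- by apply: openU => //; exact: interval_open.
- move=> x [/U01//|/=]; rewrite !in_itv /=; lra.
- move=> u v uv /not_orP[nUu nu] /not_orP[nUv nv] uvI.
  move: nu nv; rewrite /= !in_itv /= => nu nv.
  have [[x xuv xst]|no] := pselect (exists2 x, u < x < v & s < x < t).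
    have us : u = s.
      apply/eqP; rewrite eq_le; apply/andP; split; rewrite leNgt; apply/negP => h.
        by apply: nu; lra.
      have [|//|/=] := uvI s; first by lra.
      by rewrite in_itv /=; lra.
    have vt : v = t.
      apply/eqP; rewrite eq_le; apply/andP; split; rewrite leNgt; apply/negP => h.
        have [|//|/=] := uvI t; first by lra.
        by rewrite in_itv /=; lra.
      by apply: nv; lra.
    by rewrite us vt.
  apply: gU => // x xuv; have [//|/=] := uvI x xuv.
  by rewrite in_itv /= => xst; case: no; exists x.
Qed.

End path_to_arc.

Section path_arc.
Context {R : realType} {X : metricType R}.

(** Tent functions of radius 1 / (m + 1) centred at f q, for q rational:
    a countable family of 1-Lipschitz functions separating every point of the
    path from the closed sets that avoid it. Codes of no pair give 0. *)
Definition tent (f : R -> X) (n : nat) (x : X) : R :=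
  if @choice.unpickle (rat * nat)%type n is Some (q, m) then
    Num.max 0 ((m.+1)%:R^-1 - mdist x (f (ratr (q : rat))))
  else 0.

Lemma tent_bound f n x : 0 <= tent f n x <= 1.
Proof.
rewrite /tent; case: choice.unpickle => [[q m]|]; last by rewrite lexx ler01.
rewrite le_max lexx /= ge_max ler01 /= lerBlDr ler_wpDr ?mdist_ge0//.
by rewrite invf_le1 ?ltr0n// ler1n.
Qed.

Lemma tent_lip f n x y : tent f n y <= tent f n x + mdist x y.
Proof.
rewrite /tent; case: choice.unpickle => [[q m]|]; last by rewrite add0r mdist_ge0.
set z := f _; rewrite ge_max; apply/andP; split.
  by rewrite addr_ge0 ?mdist_ge0// le_max lexx.
have T := metric_triangle x y z.
set k := m.+1%:R^-1.
apply: (@le_trans _ _ (k - mdist x z + mdist x y)); first lra.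
by rewrite lerD2r le_max lexx orbT.
Qed.

Lemma tent_sep f (t e : R) : continuous f -> 0 < e ->
  exists n, 0 < tent f n (f t) /\
    forall x, e <= mdist (f t) x -> tent f n x = 0.
Proof.
move=> cf e0.
have [m me] : exists m : nat, m.+1%:R^-1 < e / 2.
  exists (Num.truncn (e / 2)^-1); rewrite invf_plt ?posrE ?ltr0n ?divr_gt0//.
  exact: truncnS_gt.
set k := m.+1%:R^-1 in me.
have k0 : 0 < k by rewrite invr_gt0 ltr0n.
have [d d0 dP] := mdist_continuous t cf k0.
have [q qI] := rat_in_itvoo (x := t - d) (y := t + d) ltac:(lra).
move: qI; rewrite in_itv /= => qI.
have h1 : mdist (f t) (f (ratr q)) < k.
  by apply: dP; rewrite ltr_norml; lra.
exists (choice.pickle (q, m)); rewrite /tent choice.pickleK; split.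
  by rewrite lt_max; apply/orP; right; rewrite -/k; lra.
move=> x ex; apply/max_idPl; rewrite -/k.
have := metric_triangle (f t) (f (ratr q)) x.
by rewrite (metric_sym x); lra.
Qed.

(** Let A be the set of parameters that survive the removal of a maximal
    family of loops. The values of f on A are totally ordered, and
    H t = L (sup of tent n on f (A up to t)) is continuous on A, takes equal
    values exactly where f does, and increases. So f factors through H, and
    the factor is injective on the segment H A: it parametrises the arc. *)
Theorem path_contains_arc (f : R -> X) : continuous f -> f 0 <> f 1 ->
  exists2 A, is_arc (f 0) (f 1) A & A `<=` f @` `[0, 1].
Proof.
move=> cf f01.
have [U [oU U01 gU maxU]] := maximal_gaps cf.
pose A := `[0, 1] `\` U.
have cA : closed A.
  by apply: closedI; [exact: interval_closed|exact: open_closedC].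
have kA : compact A.
  by apply: (subclosed_compact cA (@segment_compact _ 0 1)) => x [].
have A01 t : A t -> 0 <= t <= 1 by move=> [+ _]; rewrite /= in_itv.
have A0 : A 0.
  by split; [rewrite /= in_itv /= lexx ler01|move=> /U01; rewrite /= in_itv /= ltxx].
have A1 : A 1.
  by split; [rewrite /= in_itv /= lexx ler01|move=> /U01; rewrite /= in_itv /= ltxx andbF].
have gap s t : A s -> A t -> s < t -> (forall r, A r -> ~ s < r < t) -> f s = f t.
  move=> As At st noA; apply: gU => //; [by case: As|by case: At|].
  move=> r rI; apply: contrapT => nU; apply: (noA r) => //; split=> //.
  by rewrite /= in_itv /=; have := A01 _ As; have := A01 _ At; lra.
have inj s t : A s -> A t -> s < t -> f s = f t -> forall r, A r -> ~ s < r < t.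
  move=> As At st fst r [_ nUr] rI; apply: nUr.
  have As01 := A01 _ As; have At01 := A01 _ At.
  apply: (maxU s t) => //; [lra|lra|by case: As|by case: At].
pose vals n t := [set tent f n (f s) | s in A `&` [set s | s <= t]].
pose h n t := sup (vals n t).
have vub n t : ubound (vals n t) 1.
  by move=> _ [s _ <-]; have /andP[] := tent_bound f n (f s).
have hge n t s : A s -> s <= t -> tent f n (f s) <= h n t.
  by move=> As st; apply: ub_le_sup; [exists 1; exact: vub|exists s].
have hle n t x : A t -> (forall s, A s -> s <= t -> tent f n (f s) <= x) -> h n t <= x.
  move=> At H; apply: ge_sup; first by exists (tent f n (f t)), t => //; split=> /=.
  by move=> _ [s [As st] <-]; exact: H.
have hb t : A t -> forall n, 0 <= h n t <= 1.
  move=> At n; apply/andP; split.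
    by apply: le_trans (hge n t t At (lexx _)); have /andP[] := tent_bound f n (f t).
  by apply: hle => // s _ _; have /andP[] := tent_bound f n (f s).
have hmon s t : A s -> A t -> s <= t -> forall n, h n s <= h n t.
  by move=> As At st n; apply: hle => // r Ar rs; apply: hge => //; exact: le_trans st.
have [L LP] := @weighted_sum R.
pose H t := L (h^~ t).
have Hmon s t : A s -> A t -> s <= t -> H s <= H t.
  by move=> As At st; have [LM _ _] := LP _ _ (hb s As) (hb t At); apply: LM; exact: hmon.
(* at the right end of a removed loop the running suprema see no new point *)
have Heq0 s t : A s -> A t -> s < t -> f s = f t -> H s = H t.
  move=> As At st fst; apply/le_anti; rewrite (Hmon s t As At (ltW st)) /=.
  have [LM _ _] := LP _ _ (hb t At) (hb s As). apply: LM => n.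
  apply: hle => // r Ar rt.
  have [rs|sr] := leP r s; first exact: hge.
  have -> : r = t.
    apply/eqP; rewrite eq_le rt leNgt; apply/negP => rt'.
    by apply: (inj s t As At st fst r Ar); rewrite sr.
  by rewrite -fst; exact: hge.
(* f t is at a positive distance from the values taken up to s, hence some
   tent is positive at f t and has not been met before *)
have Hlt s t : A s -> A t -> s < t -> f s <> f t -> H s < H t.
  move=> As At st nfst.
  have kK : compact (f @` (A `&` [set r | r <= s])).
    apply: continuous_compact; first exact: continuous_subspaceT.
    by apply: compact_closedI => //; exact: closed_le.
  have [e e0 eP] : exists2 e, 0 < e & forall r, A r -> r <= s -> e <= mdist (f t) (f r).
    have /nbhs_ballP[e /= e0 eP] : nbhs (f t) (~` (f @` (A `&` [set r | r <= s]))).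
      apply: open_nbhs_nbhs; split.
        apply: closed_openC; apply: compact_closed kK; exact: metric_hausdorff.
      move=> [r [Ar /= rs] frt].
      have rt : r < t := le_lt_trans rs st.
      have := inj r t Ar At rt frt s As; rewrite st andbT.
      move: rs; rewrite le_eqVlt => /predU1P[rs|->] //.
      by rewrite -rs in nfst.
    exists e => // r Ar rs; rewrite leNgt; apply/negP => fr.
    by apply: (eP (f r)); [rewrite ballEmdist|exists r].
  have [n [tn sep]] := tent_sep t cf e0.
  have [_ LS _] := LP _ _ (hb s As) (hb t At).
  apply: (LS _ n); first by apply: hmon => //; exact: ltW.
  apply: (@le_lt_trans _ _ 0).
    by apply: hle => // r Ar rs; rewrite sep//; exact: eP.
  by apply: lt_le_trans (hge n t t At (lexx _)).
have Hf s t : A s -> A t -> (H s = H t <-> f s = f t).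
  move=> As At; have [st|ts|->//] := ltgtP s t; split=> E.
  - by apply: contrapT => /(Hlt _ _ As At st); rewrite E ltxx.
  - exact: Heq0.
  - by apply: contrapT => /nesym /(Hlt _ _ At As ts); rewrite E ltxx.
  - by apply/esym; exact: Heq0.
have Hlip s t e : A s -> A t -> s <= t -> 0 <= e ->
    (forall r, A r -> s <= r -> r <= t -> mdist (f s) (f r) <= e) -> H t <= H s + e.
  move=> As At st e0 de; have [_ _ LE] := LP _ _ (hb s As) (hb t At).
  apply: LE => // n; apply: hle => // r Ar rt.
  have [rs|sr] := leP r s; first by apply: le_trans (hge n s r Ar rs) _; rewrite lerDl.
  apply: le_trans (tent_lip f n (f s) (f r)) _.
  by apply: lerD; [exact: hge|apply: de => //; exact: ltW].
have cH : {within A, continuous H}.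
  apply/subspace_continuousP => t At; apply/cvgrPdist_le => /= e e0.
  have e20 : 0 < e / 2 by rewrite divr_gt0.
  have [d d0 dP] := mdist_continuous t cf e20.
  have : nbhs t (ball t d) by exact: nbhsx_ballx.
  apply: filterS => s; rewrite -ball_normE /= => std As.
  have [st|ts] := leP t s.
    rewrite ler0_norm ?subr_le0 ?Hmon// opprB lerBlDl.
    apply: Hlip => //; first exact: ltW.
    move=> r Ar tr rs; apply: ltW; apply: lt_trans (_ : e / 2 < e); last lra.
    by apply: dP; rewrite ger0_norm ?subr_ge0//; move: std; rewrite ler0_norm; lra.
  rewrite ger0_norm ?subr_ge0 ?(Hmon s t As At (ltW ts))// lerBlDl.
  have near r : A r -> s <= r -> r <= t -> mdist (f t) (f r) < e / 2.
    move=> Ar sr rt; apply: dP; rewrite ler0_norm ?subr_le0//.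
    by move: std; rewrite ger0_norm; lra.
  apply: Hlip => //; [exact: ltW|exact: ltW|].
  move=> r Ar sr rt; have := metric_triangle (f s) (f t) (f r).
  have := near r Ar sr rt; have := near s As (lexx _) (ltW ts).
  by rewrite (metric_sym (f t) (f s)); lra.
have cdlt : H 0 < H 1 by apply: Hlt.
set c := H 0 in cdlt; set d := H 1 in cdlt.
have AHcd t : A t -> c <= H t <= d.
  by move=> At; have /andP[t0 t1] := A01 _ At; rewrite !Hmon.
(* a value skipped by H would give a gap of A, at the ends of which H agrees *)
have surj r : c <= r <= d -> exists2 t, A t & H t = r.
  move=> /andP[cr rd].
  have [|||s [As Hs] sP] := @closed_has_max _ (A `&` H @^-1` [set x | x <= r]) 1.
  - by apply: closed_within_preimage => //; exact: closed_le.
  - by exists 0.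
  - by move=> t [/A01/andP[]].
  have [|||s' [As' Hs'] s'P] := @closed_has_min _ (A `&` H @^-1` [set x | r <= x]) 0.
  - by apply: closed_within_preimage => //; exact: closed_ge.
  - by exists 1.
  - by move=> t [/A01/andP[]].
  rewrite /= in Hs Hs'.
  have [ss|ss] := leP s' s.
    exists s => //; apply/le_anti; rewrite Hs /=.
    by apply: le_trans Hs' _; exact: Hmon.
  exists s => //; apply/le_anti; rewrite Hs /=.
  apply: le_trans Hs' _; rewrite le_eqVlt; apply/orP; left; apply/eqP; apply/esym.
  apply/Hf => //; apply: gap => // t At sts'.
  have [Htr|rHt] := leP (H t) r; first by have := sP t (conj At Htr); lra.
  by have := s'P t (conj At (ltW rHt)); lra.
pose clamp r := Num.max c (Num.min r d).
have clampI r : c <= clamp r <= d.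
  by rewrite /clamp le_max lexx /= ge_max ge_min lexx orbT andbT ltW.
have clampid r : c <= r <= d -> clamp r = r.
  by move=> /andP[cr rd]; rewrite /clamp min_l// max_r.
have cclamp : continuous clamp.
  apply: (max_fun_continuous (f := cst c)); first by move=> r; exact: cvg_cst.
  by apply: (min_fun_continuous (f := id)) => r; [exact: cvg_id|exact: cvg_cst].
have /choice[tau tauP] : forall r, exists t, A t /\ H t = clamp r.
  by move=> r; have [t At Ht] := surj _ (clampI r); exists t.
pose g r := f (tau r).
have cg : continuous g.
  apply/continuous_closedP => D cD.
  have -> : g @^-1` D = clamp @^-1` (H @` (A `&` f @^-1` D)).
    apply/seteqP; split=> r /=; have [Ar Hr] := tauP r.
      by move=> Dr; exists (tau r).
    move=> [t [At Dt] Ht]; rewrite /g.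
    by have -> : f (tau r) = f t by apply/Hf => //; rewrite Ht.
  apply: (continuous_closedP _).1 => //; apply: compact_closed; first exact: Rhausdorff.
  apply: continuous_compact; first by apply: continuous_subspaceW cH => x [].
  by apply: compact_closedI => //; exact: (continuous_closedP _).1.
have gH t : A t -> g (H t) = f t.
  by move=> At; have [Ar Hr] := tauP (H t); apply/Hf => //; rewrite Hr clampid// AHcd.
exists (g @` `[c, d]).
  rewrite -(gH 0)// -(gH 1)//; apply: arcI => // r s; rewrite !in_itv /= => rI sI.
  have [Ar Hr] := tauP r; have [As Hs] := tauP s.
  by move=> /Hf-/(_ Ar As); rewrite Hr Hs !clampid.
by move=> _ [r _ <-]; have [[tI _] _] := tauP r; exists (tau r).
Qed.

End path_arc.

(** * Paths in locally connected compact spaces *)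

Section local_path.
Context {R : realType} {X : metricType R}.
Variable E : set X.
Hypotheses (kE : compact E) (lcE : locally_connected E).

Definition linked (e : R) (x y : X) := exists Q : set X,
  [/\ Q `<=` E, connected Q, Q x, Q y & forall u v, Q u -> Q v -> mdist u v <= e].

Lemma linked_sym e x y : linked e x y -> linked e y x.
Proof. by move=> [Q [? ? ? ? ?]]; exists Q. Qed.

Lemma linked_refl e x : 0 <= e -> E x -> linked e x x.
Proof.
move=> e0 Ex; exists [set x]; split=> //; first by move=> _ ->.
  exact: connected1.
by move=> _ _ -> ->; rewrite mdistxx.
Qed.

Lemma linked_dist e x y : linked e x y -> mdist x y <= e.
Proof. by move=> [Q [_ _ Qx Qy]]; apply. Qed.

Lemma linked_nbhs e x : 0 < e -> E x ->
  exists V, [/\ open V, V x & forall y, E y -> V y -> linked e x y].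
Proof.
move=> e0 Ex; have e20 : 0 < e / 2 by rewrite divr_gt0.
have [V [oV Vx VB cV]] := lcE Ex (nbhsx_ballx x _ e20).
exists V; split=> // y Ey Vy; exists (V `&` E); split=> //.
move=> u v /VB + /VB; rewrite !ballEmdist /= => xu xv.
have := metric_triangle u x v; rewrite (metric_sym u x); lra.
Qed.

(** Local connectedness makes reachability by chains with links of size
    e' locally constant, hence constant on the connected set that links x to
    y. All points of the chain lie in that set, so they stay close to x. *)
Lemma linked_refine e e' x y : linked e x y -> 0 < e' ->
  exists (n : nat) (w : nat -> X), [/\ w 0%N = x, forall j, (n <= j)%N -> w j = y,
    forall j, linked e' (w j) (w j.+1) & forall j, mdist x (w j) <= e].
Proof.
move=> [Q [QE cQ Qx Qy Qd]] e0.
pose P := [set v | exists (n : nat) (w : nat -> X), [/\ w 0%N = x,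
    forall j, (n <= j)%N -> w j = v, forall j, linked e' (w j) (w j.+1) &
    forall j, Q (w j)]].
suff /(_ y Qy) [n [w [w0 wn wl wQ]]] : Q `<=` P.
  by exists n, w; split=> // j; apply: Qd.
have ext u v : Q u -> Q v -> linked e' u v -> P u -> P v.
  move=> Qu Qv uv [n [w [w0 wn wl wQ]]].
  exists n.+1, (fun j => if (j <= n)%N then w j else v); split.
  - by rewrite leq0n.
  - by move=> j nj; rewrite leqNgt nj.
  - move=> j; case: ltngtP => jn.
    + exact: wl.
    + by apply: linked_refl; [exact: ltW|exact: QE].
    + by rewrite wn// jn.
  - by move=> j; case: ifP.
apply: (connected_clopen_ind cQ Qx).
  exists 0%N, (fun=> x); split=> // j.
  by apply: linked_refl; [exact: ltW|exact: QE].
move=> u Qu; have [V [oV Vu VP]] := linked_nbhs e0 (QE _ Qu).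
exists V; first exact: open_nbhs_nbhs.
move=> v Qv Vv; have uv := VP v (QE _ Qv) Vv.
by split; apply: ext => //; exact: linked_sym.
Qed.

(* The sequence is constant after its s.1 links, so that chains of different
   lengths can be compared at a common length. *)
Let chain z z' e (s : nat * (nat -> X)) := [/\ (0 < s.1)%N, s.2 0%N = z,
  forall j, (s.1 <= j)%N -> s.2 j = z' & forall j, linked e (s.2 j) (s.2 j.+1)].

(** Every link is replaced by a chain of N smaller links, with the same N
    for all of them: then step functions of successive chains are compared by
    dividing indices by N. *)
Lemma chain_refine z z' e e' s : E z' -> 0 < e -> 0 < e' -> chain z z' e s ->
  exists s', chain z z' e' s' /\ exists2 N, (0 < N)%N &
    s'.1 = (s.1 * N)%N /\ forall m, mdist (s.2 (m %/ N)%N) (s'.2 m) <= e.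
Proof.
case: s => M w Ez' e0 e0' [/= M0 w0 wM wl].
have /choice[nv H] : forall i, exists nv : nat * (nat -> X),
   [/\ nv.2 0%N = w i,
      forall j, (nv.1 <= j)%N -> nv.2 j = w i.+1,
      forall j, linked e' (nv.2 j) (nv.2 j.+1),
      forall j, mdist (w i) (nv.2 j) <= e & (M <= i)%N -> forall j, nv.2 j = z'].
  move=> i; have [Mi|iM] := leqP M i.
    exists (0%N, fun=> z'); split=> //=.
    - by rewrite wM.
    - by rewrite wM// leqW.
    - by move=> _; apply: linked_refl => //; exact: ltW.
    - by move=> _; rewrite wM// mdistxx ltW.
  have [n [v [v0 vn vl vd]]] := linked_refine (wl i) e0'.
  by exists (n, v).
pose N := (\max_(i < M) (nv i).1).+1.
have vN i j : (N <= j)%N -> (nv i).2 j = w i.+1.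
  have [_ vn _ _ vz] := H i.
  move=> Nj; have [Mi|iM] := leqP M i; first by rewrite vz// wM// leqW.
  apply: vn; apply: leq_trans Nj; apply: leqW.
  exact: (leq_bigmax (F := fun i : 'I_M => (nv i).1) (Ordinal iM)).
pose w' m := (nv (m %/ N)%N).2 (m %% N)%N.
exists ((M * N)%N, w'); split; last first.
  by exists N => //; split=> // m; rewrite /w' /=; have [] := H (m %/ N)%N.
split=> /=.
- by rewrite muln_gt0 M0.
- by rewrite /w' div0n mod0n; have [-> _ _ _ _] := H 0%N.
- move=> j Mj; rewrite /w'; have [_ _ _ _ -> //] := H (j %/ N)%N.
  by rewrite leq_divRL.
- move=> m; rewrite {1}/w'; have [_ _ vl _ _] := H (m %/ N)%N.
  suff -> : w' m.+1 = (nv (m %/ N)%N).2 (m %% N).+1 by [].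
  rewrite /w'; set i := (m %/ N)%N; set j := (m %% N)%N.
  have mE : m = (i * N + j)%N by rewrite -divn_eq.
  have jN : (j < N)%N by rewrite ltn_mod.
  move: jN; rewrite leq_eqVlt => /predU1P[jN|jN].
    have mE' : m.+1 = (i.+1 * N)%N by rewrite mE -addnS jN mulSn addnC.
    have Nj : (N <= j.+1)%N by rewrite jN.
    rewrite mE' mulnK// modnMl (vN _ _ Nj).
    by have [-> _ _ _ _] := H i.+1.
  by rewrite mE -addnS divnMDl// modnMDl divn_small// modn_small// addn0.
Qed.

Lemma truncn_divn (x : R) (N : nat) : 0 <= x -> (0 < N)%N ->
  (Num.truncn (x * N%:R) %/ N)%N = Num.truncn x.
Proof.
move=> x0 N0; apply/esym/truncn_def.
set n := Num.truncn _; have /andP[h1 h2] : n%:R <= x * N%:R < n.+1%:R.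
  by apply: truncn_itv; rewrite mulr_ge0.
have NR : 0 < N%:R :> R by rewrite ltr0n.
apply/andP; split.
  rewrite -(ler_pM2r NR) -natrM; apply: le_trans h1; rewrite ler_nat.
  exact: leq_trunc_div.
rewrite -(ltr_pM2r NR) -natrM; apply: lt_le_trans h2 _; rewrite ler_nat.
exact: ltn_ceil.
Qed.

(** The path is the uniform limit of the step functions given by
    successive refinements of the chain z, z', with links of size e / 2 ^ k at
    stage k. Compactness of E provides the limits, and two parameters at
    distance less than the inverse of the length of the k-th chain fall into
    equal or adjacent links of it, whence continuity. *)
Lemma linked_path e z z' : 0 < e -> linked e z z' -> exists f : R -> X,
  [/\ continuous f, f 0 = z, f 1 = z' & forall t, E (f t) /\ mdist z (f t) <= 3 * e].
Proof.
move=> e0 zz'; have [Ez Ez'] : E z /\ E z' by case: zz' => Q [QE _ /QE ? /QE ?].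
pose ee k := e * 2^-1 ^+ k.
have ee0 k : 0 < ee k by rewrite mulr_gt0// exprn_gt0// invr_gt0.
have eeS k : ee k = 2 * ee k.+1 by rewrite /ee exprS; field.
have /choice[step stepP] : forall ks : nat * (nat * (nat -> X)), exists s',
    chain z z' (ee ks.1) ks.2 -> chain z z' (ee ks.1.+1) s' /\
    exists2 N, (0 < N)%N & s'.1 = (ks.2.1 * N)%N /\
      forall m, mdist (ks.2.2 (m %/ N)%N) (s'.2 m) <= ee ks.1.
  move=> [k s] /=; have [cs|ncs] := pselect (chain z z' (ee k) s); last by exists s.
  by have [s' H] := chain_refine Ez' (ee0 k) (ee0 k.+1) cs; exists s'.
pose s := fix s k := if k is k'.+1 then step (k', s k') else
  (1%N, fun j => if j is 0%N then z else z').
have sP k : chain z z' (ee k) (s k).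
  elim: k => [|k IH] /=; last by have [] := stepP (k, s k) IH.
  split=> //=; first by case.
  case=> [|j]; first by rewrite /ee expr0 mulr1.
  by apply: linked_refl; [exact: ltW|].
have EP k j : E ((s k).2 j).
  by have [_ _ _ /(_ j) [Q [QE _ /QE]]] := sP k.
pose clamp (t : R) := Num.max 0 (Num.min t 1).
have clampI t : 0 <= clamp t <= 1.
  by rewrite /clamp le_max lexx /= ge_max ge_min lexx orbT andbT ler01.
have clampid t : 0 <= t <= 1 -> clamp t = t.
  by move=> /andP[cr rd]; rewrite /clamp min_l// max_r.
have clamp_lip u t : `|clamp u - clamp t| <= `|u - t|.
  have lip0 (x y : R) : `|Num.max 0 x - Num.max 0 y| <= `|x - y|.
    by case: (leP 0 x) => hx; case: (leP 0 y) => hy; rewrite ler_norml;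
      case: (ler0P (x - y)) => hxy; lra.
  apply: le_trans (lip0 _ _) _.
  by case: (leP u 1) => hx; case: (leP t 1) => hy; rewrite ler_norml;
      case: (ler0P (u - t)) => hxy; lra.
pose g k t := (s k).2 (Num.truncn (clamp t * (s k).1%:R)).
have gS k t : mdist (g k t) (g k.+1 t) <= ee k.
  have [_ [N N0 [MN H]]] := stepP (k, s k) (sP k).
  have /andP[c0 _] := clampI t.
  have x0 : 0 <= clamp t * (s k).1%:R by rewrite mulr_ge0.
  have := H (Num.truncn (clamp t * (s k).1%:R * N%:R)).
  have {}MN : (s k.+1).1 = ((s k).1 * N)%N := MN.
  by rewrite truncn_divn// /g MN natrM mulrA.
have gD k j t : mdist (g k t) (g (k + j)%N t) <= 2 * ee k - 2 * ee (k + j)%N.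
  elim: j => [|j IH]; first by rewrite addn0 mdistxx subrr.
  apply: le_trans (metric_triangle _ (g (k + j)%N t) _) _.
  have := gS (k + j)%N t; rewrite -addnS; have := eeS (k + j)%N; rewrite -addnS.
  by move: IH; lra.
have /choice[f fP] : forall t, exists p, E p /\ forall k, mdist (g k t) p <= 2 * ee k.
  move=> t; have [|p [Ep cp]] := kE (F := (g^~ t) @ \oo).
    by exists 0%N => // k _; exact: EP.
  exists p; split=> // k; apply/ler_addgt0Pl => d d0.
  have [|_ [[j /= kj <-] pj]] := cp [set g j t | j in [set j | (k <= j)%N]]
      _ _ (nbhsx_ballx p _ d0).
    by exists k => // j /= kj; exists j.
  have := gD k (j - k)%N t; rewrite subnKC// => gkj.
  rewrite ballEmdist /= in pj; rewrite metric_sym in pj.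
  have := metric_triangle (g k t) (g j t) p; have := ee0 j; lra.
have small d : 0 < d -> exists k, 5 * ee k < d.
  move=> d0; have [k kP] : exists k, (e * 5) < d * 2 ^+ k.
    exists (Num.truncn (e * 5 / d)).+1.
    rewrite [d * _]mulrC -ltr_pdivrMr//; apply: lt_trans (truncnS_gt _) _.
    by rewrite -natrX ltr_nat; exact: ltn_expl.
  exists k; rewrite /ee exprVn mulrA [5 * _]mulrC ltr_pdivrMr// exprn_gt0.
have eqlim t p : (forall k, g k t = p) -> f t = p.
  move=> gp; apply/esym; apply: mdist_positivity; apply/eqP.
  rewrite eq_le mdist_ge0 andbT leNgt; apply/negP => /small[k].
  by have [_ /(_ k)] := fP t; rewrite gp; have := ee0 k; lra.
exists f; split.
- move=> t; apply/cvg_ballP => d d0; have [k kd] := small d d0.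
  have [M0 _ _ wl] := sP k; set M := (s k).1 in M0.
  have MR : 0 < M%:R :> R by rewrite ltr0n.
  have : nbhs t (ball t M%:R^-1) by apply: nbhsx_ballx; rewrite invr_gt0.
  apply: filterS => u; rewrite -ball_normE /= => tu; rewrite ballEmdist /=.
  have [_ /(_ k) ft] := fP t; have [_ /(_ k) fu] := fP u.
  suff gtu : mdist (g k t) (g k u) <= ee k.
    have := metric_triangle (f t) (g k t) (f u).
    have := metric_triangle (g k t) (g k u) (f u).
    by rewrite (metric_sym (f t) (g k t)); have := ee0 k; lra.
  rewrite /g -/M; set x := clamp t * _; set y := clamp u * _.
  have xy : `|x - y| < 1.
    rewrite -mulrBl normrM (ger0_norm (ltW MR)) -ltr_pdivlMr// mul1r.
    exact: le_lt_trans (clamp_lip _ _) tu.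
  have x0 : 0 <= x by rewrite mulr_ge0//; have /andP[] := clampI t.
  have y0 : 0 <= y by rewrite mulr_ge0//; have /andP[] := clampI u.
  have /andP[x1 x2] := truncn_itv x0; have /andP[y1 y2] := truncn_itv y0.
  set a := Num.truncn x in x1 x2 *; set b := Num.truncn y in y1 y2 *.
  have ab : (a <= b.+1)%N.
    by rewrite -ltnS -(ltr_nat R) -natr1; move: xy; rewrite ltr_norml; lra.
  have ba : (b <= a.+1)%N.
    by rewrite -ltnS -(ltr_nat R) -natr1; move: xy; rewrite ltr_norml; lra.
  have [ltab|ltba|->] := ltngtP a b.
  + have -> : b = a.+1 by apply/eqP; rewrite eqn_leq ba ltab.
    exact: linked_dist.
  + have -> : a = b.+1 by apply/eqP; rewrite eqn_leq ab ltba.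
    by rewrite metric_sym; exact: linked_dist.
  + by rewrite mdistxx ltW.
- apply: eqlim => k; rewrite /g clampid ?lexx ?ler01// mul0r truncn0.
  by have [_ -> _ _] := sP k.
- apply: eqlim => k; rewrite /g clampid ?lexx ?ler01// mul1r natrK.
  by have [_ _ -> //] := sP k.
- move=> t; have [Et /(_ 0%N)] := fP t; rewrite [ee 0%N]mulr1 => h.
  split=> //; have := metric_triangle z (g 0%N t) (f t).
  suff : mdist z (g 0%N t) <= e by lra.
  rewrite /g /=; case: (Num.truncn _) => [|j]; first by rewrite mdistxx ltW.
  exact: linked_dist.
Qed.

End local_path.

(** * Arcs and circles in locally connected compact spaces *)

Section arc_theorem.
Context {R : realType} {X : metricType R}.
Implicit Types (E U : set X).

(** Being joined by an arc is an equivalence relation, and its classes are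
    open by local connectedness and the construction of paths between linked
    points. *)
Lemma arc_in_open E U x y : compact E -> locally_connected E -> open U ->
  connected (E `&` U) -> (E `&` U) x -> (E `&` U) y -> x <> y ->
  exists2 A, is_arc x y A & A `<=` E `&` U.
Proof.
move=> kE lcE oU cO Ox Oy xy; set O := E `&` U in cO Ox Oy *.
pose J u v := u = v \/ exists2 A, is_arc u v A & A `<=` O.
suff : J x y by case.
have Jsym u v : J u v -> J v u.
  by move=> [->|[A /arc_sym aA AO]]; [left|right; exists A].
have Jtrans u v w : J u v -> J v w -> J u w.
  move=> [->//|[A aA AO]] [<-|[B aB BO]]; first by right; exists A.
  have [->|uw] := pselect (u = w); first by left.
  right; have [C aC CAB] := arc_trans aA aB uw.
  by exists C => // z /CAB[/AO|/BO].
suff : O `<=` J x by apply.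
apply: (connected_clopen_ind cO Ox); first by left.
move=> u [Eu Uu].
have /nbhs_ballP[r /= r0 rU] : nbhs u U by apply: open_nbhs_nbhs.
have e0 : 0 < r / 4 by rewrite divr_gt0.
have [V [oV Vu VP]] := linked_nbhs lcE e0 Eu.
exists V; first exact: open_nbhs_nbhs.
move=> v [Ev Uv] Vv.
suff Juv : J u v by split=> [/Jtrans|/Jtrans]; apply=> //; exact: Jsym.
have [->|uv] := pselect (u = v); first by left.
have [f [cf f0 f1 fE]] := linked_path kE lcE e0 (VP v Ev Vv).
have [|A aA Af] := path_contains_arc cf; first by rewrite f0 f1.
right; exists A; first by rewrite -f0 -f1.
move=> _ /Af[t _ <-]; have [Et ut] := fE t; split=> //; apply: rU.
by rewrite ballEmdist /=; lra.
Qed.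

(** Join p and q by an arc in the connected set, which avoids a, and
    apply the theta lemma. *)
Lemma circle_through E U A p q a : compact E -> locally_connected E -> open U ->
  connected (E `&` U) -> (E `&` U) p -> (E `&` U) q ->
  is_arc p q A -> A a -> a <> p -> a <> q -> ~ (E `&` U) a ->
  exists C, [/\ is_circle R C, C a & C `<=` A `|` (E `&` U)].
Proof.
move=> kE lcE oU cO Op Oq aA Aa ap aq na.
have [B aB BO] := arc_in_open kE lcE oU cO Op Oq (arc_neq aA).
have [C [cC Ca CAB]] := theta_circle aA Aa ap aq aB (fun Ba => na (BO _ Ba)).
by exists C; split=> // z /CAB[|/BO]; [left|right].
Qed.

(** The component of p in the complement of a is relatively open in E, so
    the previous lemma applies to it. *)
Lemma circle_of_nonseparating E A p q a : compact E -> locally_connected E ->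
  is_arc p q A -> A `<=` E -> A a -> a <> p -> a <> q ->
  connected_component (E `\ a) p q ->
  exists C, [/\ is_circle R C, C a & C `<=` E].
Proof.
move=> kE lcE aA AE Aa ap aq cpq.
have oa : open (~` [set a]).
  by apply: closed_openC; apply: compact_closed; [exact: metric_hausdorff|exact: compact_set1].
have [U oU UE] := component_open p lcE oa.
have pE : (E `\ a) p by split; [apply: AE; exact: arc_left aA|exact: nesym].
have [||||C [cC Ca CAU]] := @circle_through E U A p q a kE lcE oU _ _ _ aA Aa ap aq.
- by rewrite -UE; exact: component_connected.
- by rewrite -UE; exact: connected_component_refl.
- by rewrite -UE.
- by rewrite -UE => /connected_component_sub[_ /(_ erefl)].
by exists C; split=> // z /CAU[/AE|[]].
Qed.

Lemma arc_end_closed (p q : X) A F : is_arc p q A -> closed F -> A `\ q `<=` F -> F q.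
Proof.
move=> aA cF AF; apply: contrapT => nFq.
suff E : [set q] = A.
  by apply: (arc_neq aA); have := arc_left aA; rewrite -E.
apply: (arc_connected aA); first by exists q.
- exists (~` F); first exact: closed_openC.
  apply/seteqP; split=> [_ ->|y [Ay nFy]]; first by split=> //; exact: arc_right aA.
  by apply: contrapT => yq; apply: nFy; apply: AF.
- exists [set q]; first by apply: compact_closed; [exact: metric_hausdorff|exact: compact_set1].
  apply/seteqP; split=> [_ ->|y []//]; by split=> //; exact: arc_right aA.
Qed.

End arc_theorem.

(** * Circles in local dendrites *)

Section finite_unions.

Lemma finite_set_unions (T : Type) (J : set (set T)) (CC : set (set T)) :
  finite_set J ->
  (forall C, CC C -> forall c, C c -> exists2 D, J D & D c /\ D `<=` C) ->
  finite_set CC.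
Proof.
move=> /finite_seqP[s ->] CJ.
pose fam := fix fam (s : seq (set T)) : seq (set T) :=
  if s is x :: s' then fam s' ++ [seq x `|` y | y <- fam s'] else [:: set0].
apply: (sub_finite_set _ (finite_seq (fam s))) => C CCC /=.
pose u := fix u (s : seq (set T)) : set T :=
  if s is x :: s' then (if `[< x `<=` C >] then x `|` u s' else u s') else set0.
have uC t : u t `<=` C.
  elim: t => [//|x t IH] /=; case: asboolP => // xC.
  by rewrite subUset.
have su t D : D \in t -> D `<=` C -> D `<=` u t.
  elim: t => [//|x t IH] /=; rewrite inE => /predU1P[->|Dt] DC.
    by case: asboolP => // _; exact: subsetUl.
  case: asboolP => // _; last exact: IH.
  by apply: subset_trans (@subsetUr _ _ _); exact: IH.
have <- : u s = C.
  apply/seteqP; split=> // c Cc; have [D Ds [Dc DC]] := CJ C CCC c Cc.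
  exact: (su s D Ds DC).
elim: s {CJ} => [|x s IH] /=; first by rewrite inE.
rewrite mem_cat; case: asboolP => _; last by rewrite IH.
by rewrite map_f ?orbT.
Qed.

End finite_unions.

Section local_dendrites.
Context {R : realType} {X : metricType R}.
Implicit Types (V W C : set X).

Lemma closed_set1 (x : X) : closed [set x].
Proof. by apply: compact_closed; [exact: metric_hausdorff|exact: compact_set1]. Qed.

Lemma local_dendrite_lc : local_dendrite X -> locally_connected [set: X].
Proof.
move=> [_ ldX] x _ U nU; have [V nV [_ lcV _]] := ldX x.
have Vx : V x := nbhs_singleton nV.
have [W [oW Wx WU cW]] := lcV x Vx (U `&` V^°) (filterI nU (nbhs_interior nV)).
exists (W `&` V^°); split; rewrite ?setIT.
- by apply: openI => //; exact: open_interior.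
- by split=> //.
- by move=> y [Wy Vy]; have [] := WU y (conj Wy (interior_subset Vy)).
- suff -> : W `&` V^° = W `&` V by [].
  apply/seteqP; split=> y [Wy Vy]; split=> //; first exact: interior_subset.
  by have [] := WU y (conj Wy Vy).
Qed.

Lemma dendrite_arc V x y : dendrite V -> V x -> V y -> x <> y ->
  exists2 A, is_arc x y A & A `<=` V.
Proof.
move=> [[kV cV] lcV _] Vx Vy xy.
by have := @arc_in_open _ _ V setT x y kV lcV openT; rewrite setIT; apply.
Qed.

(** Otherwise a would lie on a circle contained in V. *)
Lemma dendrite_separates V p q a (A : set X) : dendrite V -> is_arc p q A ->
  A `<=` V -> A a -> a <> p -> a <> q -> ~ connected_component (V `\ a) p q.
Proof.
move=> [[kV cV] lcV nC] aA AV Aa ap aq cpq; apply: nC.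
by have [C [cC _ CV]] := circle_of_nonseparating kV lcV aA AV Aa ap aq cpq; exists C.
Qed.

Lemma closed_mball (x : X) (r : R) : closed [set y | mdist x y <= r].
Proof.
rewrite -openC; rewrite openE => y /= /negP; rewrite -ltNge => ry.
have e0 : 0 < mdist x y - r by rewrite subr_gt0.
apply: filterS (nbhsx_ballx y _ e0) => z; rewrite ballEmdist /= => yz xz.
by have := metric_triangle x z y; rewrite (metric_sym z); lra.
Qed.

Lemma open_mball (x : X) (r : R) : open (ball x r).
Proof.
rewrite openE => y; rewrite ballEmdist /= => xy.
have e0 : 0 < r - mdist x y by rewrite subr_gt0.
apply: filterS (nbhsx_ballx y _ e0) => z; rewrite !ballEmdist /= => yz.
by have := metric_triangle x y z; lra.
Qed.

(** Each point of a small sphere S about x is separated from x by a point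
    of V; by compactness finitely many points P separate x from all of S. The
    component of x in the complement of P does not cross S, and its boundary
    consists of points of P. *)
Lemma dendrite_regular V x : nbhs x V -> dendrite V ->
  exists W P, [/\ open W, W x, closure W `<=` V, finite_set P &
    closure W `\` W `<=` P].
Proof.
move=> nV dV; have [[kV cV] lcV nCV] := dV; have Vx := nbhs_singleton nV.
have /nbhs_ballP[r2 /= r20 rV] := nV.
pose r := r2 / 2; have r0 : 0 < r by rewrite divr_gt0.
have ballV y : mdist x y <= r -> V y.
  by move=> h; apply: rV; rewrite ballEmdist /=; move: h r20; rewrite /r; lra.
pose S := [set y | mdist x y = r].
have cS : closed S.
  have -> : S = [set y | mdist x y <= r] `&` ~` ball x r.
    apply/seteqP; split=> y; rewrite /S ballEmdist /=; first by move=> ->; rewrite lexx ltxx.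
    by move=> [h1 /negP]; rewrite -leNgt => h2; apply/le_anti; rewrite h1.
  apply: closedI; first exact: closed_mball.
  by apply: open_closedC; exact: (open_mball x r).
have kS : compact S by apply: (subclosed_compact cS kV) => y /= h; apply: ballV; rewrite h.
have /choice[aU aUP] : forall y, exists aU : X * set X, S y ->
    [/\ aU.1 <> x, open aU.2, aU.2 y,
       V `&` aU.2 = connected_component (V `\ aU.1) y &
       ~ connected_component (V `\ aU.1) x y].
  move=> y; have [Sy|nSy] := pselect (S y); last by exists (x, set0).
  have Vy : V y by apply: ballV; rewrite Sy.
  have xy : x <> y by move=> E; move: Sy r0; rewrite /S /= -E mdistxx => <-; rewrite ltxx.
  have [A aA AV] := dendrite_arc dV Vx Vy xy.
  have [a [Aa ax ay]] := arc_inner aA.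
  have [U oU UE] := component_open y lcV (closed_openC (@closed_set1 a)).
  exists (a, U) => _; split=> //=.
    have : connected_component (V `&` ~` [set a]) y y.
      by apply: connected_component_refl; split=> //; exact: nesym.
    by rewrite UE => -[].
  exact: (dendrite_separates dV aA AV Aa ax ay).
have [||s [sS sP]] := compact_seq_cover (D := S) (f := fun y => (aU y).2) kS.
- by move=> y /aUP[].
- by move=> y Sy; exists y => //; have [] := aUP y Sy.
pose P := [set` [seq (aU y).1 | y <- s]].
have fP : finite_set P by exact: finite_seq.
have oP : open (~` P).
  apply: closed_openC; apply: compact_closed; first exact: metric_hausdorff.
  exact: finite_compact.
have [U0 oU0 UE] := component_open x lcV oP.
set W0 := connected_component _ _ in UE.
have cW0 : connected W0 by exact: component_connected.
have W0V : W0 `<=` V by move=> y /connected_component_sub[].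
have W0x : W0 x.
  apply: connected_component_refl; split=> // /mapP[y ys xE].
  by have [] := aUP y (sS y ys); rewrite -xE.
have W0S y : W0 y -> ~ S y.
  move=> Wy Sy; have [z zs Uy] := sP y Sy.
  have [ax oU Uz UzE nxz] := aUP z (sS z zs).
  apply: nxz; apply: (@connected_component_trans _ _ y).
    exists W0 => //; split=> // w Ww; split; first exact: W0V.
    move=> /= wa; have [_] := connected_component_sub Ww; apply.
    by rewrite wa; apply: map_f.
  by apply: connected_component_sym; rewrite -UzE; split=> //; exact: W0V.
have W0r y : W0 y -> mdist x y < r.
  suff E : W0 `&` ball x r = W0.
    by rewrite -E => -[_]; rewrite ballEmdist.
  apply: cW0; first by exists x; split=> //; exact: ballxx.
    by exists (ball x r) => //; exact: (open_mball x r).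
  exists [set y | mdist x y <= r]; first exact: closed_mball.
  apply/seteqP; split=> z [Wz]; rewrite ballEmdist /= => h; split=> //; first exact: ltW.
  by rewrite lt_neqAle h andbT; apply/eqP; exact: W0S.
have WE : W0 = U0 `&` ball x r.
  apply/seteqP; split=> y.
    by move=> Wy; split; [move: Wy; rewrite UE => -[]|rewrite ballEmdist /=; exact: W0r].
  by move=> [Uy yr]; rewrite UE; split=> //; apply: ballV; move: yr; rewrite ballEmdist /=; exact: ltW.
have clV : closure W0 `<=` V.
  move=> y /closureS; move=> /(_ [set y | mdist x y <= r]) h; apply: ballV.
  by apply: (closed_mball (x := x) (r := r)); apply: h => z /W0r/ltW.
exists W0, P; split=> //.
- by rewrite WE; apply: openI => //; exact: (open_mball x r).
- move=> z [clz nWz]; apply: contrapT => nPz; apply: nWz.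
  have [U1 oU1 U1E] := component_open z lcV oP.
  have cz : connected_component (V `&` ~` P) z z.
    by apply: connected_component_refl; split=> //; exact: clV.
  have : U1 z by move: cz; rewrite U1E => -[].
  move=> /(conj oU1)/open_nbhs_nbhs/clz[w [Ww Uw]].
  apply: (connected_component_trans Ww); apply: connected_component_sym.
  by rewrite U1E; split=> //; exact: W0V.
Qed.

(** Away from P the open set W is also closed. *)
Lemma connected_sub_open (K W P : set X) : connected K -> open W ->
  closure W `\` W `<=` P -> K `&` W !=set0 -> (forall z, K z -> ~ P z) -> K `<=` W.
Proof.
move=> cK oW WP KW KP; suff <- : K `&` W = K by move=> z [].
apply: cK => //; first by exists W.
exists (closure W); first exact: closed_closure.
apply/seteqP; split=> z [Kz Wz]; split=> //; first exact: subset_closure.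
by apply: contrapT => nWz; apply: (KP z Kz); apply: WP.
Qed.

(** In a dendrite V this is the arc from p to q; defining it by separation
    shows that it depends on V, p and q alone and that every connected subset
    of V containing p and q contains it. *)
Definition seg V p q : set X :=
  [set a | V a /\ [\/ a = p, a = q | ~ connected_component (V `\ a) p q]].

(** Cover X by finitely many open sets with finite boundaries and with
    closures in dendrites, and let P be the union of the boundaries. A circle
    meets P, and the points of P cut it into arcs each of which lies in one of
    the dendrites and hence is a segment with ends in P. There are finitely
    many such segments, and a circle is the union of those it contains,
    together with its points in P. *)
Theorem finite_circles : local_dendrite X -> finite_set [set C : set X | is_circle R C].
Proof.
move=> ldX; have [[kX _] nX] := ldX.
have /choice[VWP H] : forall x, exists VWP : set X * (set X * set X),
    [/\ dendrite VWP.1, open VWP.2.1, VWP.2.1 x, closure VWP.2.1 `<=` VWP.1 &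
       finite_set VWP.2.2 /\ closure VWP.2.1 `\` VWP.2.1 `<=` VWP.2.2].
  move=> x; have [V nV dV] := nX x.
  have [W [P [oW Wx WV fP WP]]] := dendrite_regular nV dV.
  by exists (V, (W, P)).
have [||s [_ sP]] := compact_seq_cover (D := setT) (f := fun x => (VWP x).2.1) kX.
- by move=> x _; have [] := H x.
- by move=> x _; exists x => //; have [] := H x.
pose P := \bigcup_(x in [set` s]) (VWP x).2.2.
have fP : finite_set P.
  by apply: bigcup_finite; [exact: finite_seq|move=> x _; have [_ _ _ _ []] := H x].
have cP : closed P.
  by apply: compact_closed; [exact: metric_hausdorff|exact: finite_compact].
pose J := [set [set p] | p in P] `|`
  [set seg (VWP t.1).1 t.2.1 t.2.2 | t in [set` s] `*` (P `*` P)].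
apply: (@finite_set_unions _ J).
  rewrite finite_setU; split; apply: finite_image => //.
  by apply: finite_setX; [exact: finite_seq|exact: finite_setX].
move=> C /= cC c Cc.
have [Pc|nPc] := pselect (P c).
  by exists [set c]; [left; exists c|split=> // _ ->].
have [x xs Wc] := sP c I.
have [dV oW _ WV [_ WP]] := H x.
set V := (VWP x).1 in dV WV *; set W := (VWP x).2.1 in oW WV WP Wc.
have {}WP : closure W `\` W `<=` P by move=> z /WP Pz; exists x.
have nCV D : is_circle R D -> ~ D `<=` V by move=> cD DV; case: dV => _ _; apply; exists D.
have [e [Ce Pe]] : exists e, C e /\ P e.
  apply: contrapT => noe; apply: (nCV C cC).
  apply: subset_trans (subset_trans (@subset_closure _ W) WV).
  apply: (connected_sub_open (circle_connected cC) oW WP); first by exists c.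
  by move=> z Cz Pz; apply: noe; exists z.
have ce : c <> e by move=> E; rewrite E in nPc.
have [A [B [aA aB AB AIB]]] := circle_split cC Cc Ce ce.
have [|p [A1 [aA1 A1A A1P]]] := arc_first aA cP _ nPc.
  by exists e; split=> //; exact: arc_right aA.
have [|q [B1 [aB1 B1B B1P]]] := arc_first aB cP _ nPc.
  by exists e; split=> //; exact: arc_right aB.
have [A1p Pp] : (A1 `&` P) p by rewrite A1P.
have [B1q Pq] : (B1 `&` P) q by rewrite B1P.
have inW r K : is_arc c r K -> K `&` P = [set r] -> K `<=` V.
  move=> aK KP; have [Kr Pr] : (K `&` P) r by rewrite KP.
  have KW : K `\ r `<=` W.
    apply: (connected_sub_open (arc_open_connected aK) oW WP).
      by exists c; split=> //; split; [exact: arc_left aK|exact: (arc_neq aK)].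
    by move=> z [Kz zr] Pz; apply: zr; have : (K `&` P) z by []; rewrite KP.
  have clr : closure W r.
    apply: (arc_end_closed aK (@closed_closure _ W)).
    exact: subset_trans (@subset_closure _ W).
  move=> z Kz; have [->|zr] := pselect (z = r); first exact: WV.
  by apply: WV; apply: subset_closure; apply: KW.
have A1V := inW p A1 aA1 A1P; have B1V := inW q B1 aB1 B1P.
have A1IB1 z : A1 z -> B1 z -> z = c \/ z = e.
  move=> /A1A Az /B1B Bz; have : (A `&` B) z by [].
  by rewrite AIB.
(* if both directions lead to the same point of P, they close up to a circle
   inside a dendrite *)
have [pq|pq] := pselect (p = q).
  exfalso; apply: (nCV (A1 `|` B1)); last by rewrite subUset.
  rewrite -pq in aB1 B1P B1q Pq.
  apply: (circle_glue aA1 aB1); apply/seteqP; split=> z.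
    move=> [Az Bz]; have [->|zE] := A1IB1 z Az Bz; [by left|right].
    have : (A1 `&` P) z by split=> //; rewrite zE.
    by rewrite A1P.
  move=> [|] ->; split=> //; [exact: arc_left aA1|exact: arc_left aB1].
have aJ : is_arc p q (A1 `|` B1).
  apply: (arc_cat (arc_sym aA1) aB1); apply/seteqP; split=> z; last first.
    by move=> ->; split; [exact: arc_left aA1|exact: arc_left aB1].
  move=> [Az Bz]; have [//|zE] := A1IB1 z Az Bz; case: pq.
  have : (A1 `&` P) z by split=> //; rewrite zE.
  have : (B1 `&` P) z by split=> //; rewrite zE.
  by rewrite A1P B1P /= => <- <-.
have cp : c <> p by move=> E; rewrite E in nPc.
have cq : c <> q by move=> E; rewrite E in nPc.
have JV : A1 `|` B1 `<=` V by rewrite subUset.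
have JC : A1 `|` B1 `<=` C by rewrite -AB => z [/A1A|/B1B]; [left|right].
have Jc : (A1 `|` B1) c by left; exact: arc_left aA1.
exists (seg V p q); first by right; exists (x, (p, q)).
split.
  split; first exact: JV.
  by apply: Or33; exact: (dendrite_separates dV aJ JV Jc cp cq).
move=> a [Va [->|->|sep]].
- by apply: JC; exact: arc_left aJ.
- by apply: JC; exact: arc_right aJ.
apply: contrapT => nCa; apply: sep; exists (A1 `|` B1); last exact: arc_right aJ.
split; [exact: arc_left aJ| |exact: arc_connected aJ].
by move=> z Jz; split; [exact: JV|move=> za; apply: nCa; rewrite -za; exact: JC].
Qed.

End local_dendrites.

(** * Points cut off by a point *)

Section cut_order.
Context {T : topologicalType}.
Hypotheses (cT : connected [set: T]) (lcT : locally_connected [set: T]).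
Hypothesis closed1 : forall x : T, closed [set x].
Implicit Types (a b c x y z : T) (L : set T).

Lemma component_open_setT (O : set T) x : open O -> open (connected_component O x).
Proof.
move=> oO; have [U oU] := component_open x lcT oO.
by rewrite !setTI => ->.
Qed.

Definition comp a x := connected_component (~` [set a]) x.

Lemma comp_open a x : open (comp a x).
Proof. by apply: component_open_setT; apply: closed_openC; exact: closed1. Qed.

Lemma comp_refl a x : x <> a -> comp a x x.
Proof. exact: connected_component_refl. Qed.

Lemma clopen_setT (W : set T) x : open W -> closed W -> W x -> W = setT.
Proof.
move=> oW cW Wx; apply: cT; first by exists x.
  by exists W => //; rewrite setTI.
by exists W => //; rewrite setTI.
Qed.

(** If the closure of a component of the complement of a missed a, the
    component would be open and closed in the connected space T. *)
Lemma comp_closure a z : z <> a ->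
  [/\ connected (closure (comp a z)), closure (comp a z) a,
      closure (comp a z) z & closure (comp a z) `<=` comp a z `|` [set a]].
Proof.
move=> za; have sub : closure (comp a z) `<=` comp a z `|` [set a].
  move=> y cy; have [->|ya] := pselect (y = a); [by right|left].
  have [w [wz wy]] := cy _ (open_nbhs_nbhs (conj (comp_open a y) (comp_refl ya))).
  by apply: (connected_component_trans wz); exact: connected_component_sym.
split=> //.
- by apply: connected_closure; exact: component_connected.
- apply: contrapT => nca.
  have E : comp a z = setT.
    apply: (@clopen_setT _ z); [exact: comp_open| |exact: comp_refl].
    by move=> y cy; have [//|/= ya] := sub y cy; rewrite ya in cy.
  have : comp a z a by rewrite E.
  by move=> /connected_component_sub; apply.
- by apply: subset_closure; exact: comp_refl.
Qed.

Variable L : set T.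

(** With L an invariant set this relation between a and b replaces the order
    of a rooted tree, the role of the root being played by L. *)
Definition cuts a b := b <> a /\ forall z, comp a b z -> ~ L z.

Lemma cuts_irr a : ~ cuts a a.
Proof. by case. Qed.

Lemma cuts_open a : open [set b | cuts a b].
Proof.
rewrite openE => b /= [ba bL].
apply: filterS (open_nbhs_nbhs (conj (comp_open a b) (comp_refl ba))) => c bc.
split; first by move=> ca; have := connected_component_sub bc; rewrite ca => /(_ erefl).
by move=> z cz; apply: bL; exact: connected_component_trans cz.
Qed.

(** Let C be the component of c in the complement of b. If a is not in C,
    then the closure of C, which contains b, connects c to b in the complement
    of a. If a is in C, then so is everything that can be joined to a without
    meeting b, in particular L, since b is cut off from L by a; this is
    absurd. *)
Lemma cuts_trans a b c : L !=set0 -> cuts a b -> cuts b c -> cuts a c.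
Proof.
move=> [l Ll] [ba bL] [cb cL].
have [kc clb clc csub] := comp_closure cb.
have nca : ~ comp b c a.
  move=> bca; apply: (cL l) => //.
  have nbl : ~ comp a b l by move=> /bL.
  apply: (connected_component_trans bca).
  have [->|la] := pselect (l = a); first by apply: connected_component_refl; exact: nesym.
  have [kl cla cll lsub] := comp_closure la.
  exists (closure (comp a l)) => //; split=> // y /lsub[ly|->]; last by exact: nesym.
  by move=> /= yb; apply: nbl; apply: connected_component_sym; rewrite -yb.
have abc : comp a b c.
  exists (closure (comp b c)) => //; split=> // y /csub[cy|->] //.
  by move=> /= ya; apply: nca; rewrite -ya.
split; first by move=> ca; apply: nca; rewrite -ca; exact: comp_refl.
by move=> z cz; apply: bL; exact: connected_component_trans cz.
Qed.

Lemma seq_minimal (r : T -> T -> Prop) (s : seq T) x0 :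
  (forall x, ~ r x x) -> (forall x y z, r x y -> r y z -> r x z) ->
  x0 \in s -> exists2 m, m \in s & forall z, z \in s -> ~ r z m.
Proof.
move=> irr tr; elim: s x0 => [//|x [|y s] IH] x0 _.
  by exists x; rewrite ?inE// => z; rewrite inE => /eqP->; exact: irr.
have [|m ms mP] := IH y; first by rewrite inE eqxx.
have [rxm|nrxm] := pselect (r x m); last first.
  by exists m; rewrite 1?inE ?ms ?orbT// => z; rewrite inE => /predU1P[->//|/mP].
exists x; first by rewrite inE eqxx.
move=> z; rewrite inE => /predU1P[->//|zs rzx].
by apply: (mP z zs); exact: tr rxm.
Qed.

End cut_order.

(** * Minimal sets of group actions *)

Section dynamics.
Context {R : realType} {X : metricType R} {G : groupType} (act : G -> X -> X).
Hypothesis gact : is_group_action act.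
Implicit Types (H : set G) (M N : set X).

Lemma act_continuous g : continuous (act g).
Proof.
have [c _ _] := gact => x.
pose i (y : X) : discrete_topology G * X := (g, y).
have ci : continuous i.
  move=> y.
  have c1 : (fun=> g : discrete_topology G) @ y --> (g : discrete_topology G).
    exact: cvg_cst.
  have c2 : id @ y --> y by exact: cvg_id.
  exact: (cvg_pair c1 c2).
by apply: (@continuous_comp _ _ _ i (fun p => act p.1 p.2)); [exact: ci|exact: c].
Qed.

Lemma actK g x : act g^-1%g (act g x) = x.
Proof. by have [_ a1 aM] := gact; rewrite -aM mulVg a1. Qed.

Lemma actKV g x : act g (act g^-1%g x) = x.
Proof. by have [_ a1 aM] := gact; rewrite -aM mulgV a1. Qed.

Lemma act_inj g : injective (act g).
Proof. exact: can_inj (actK g). Qed.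

Lemma act_image g N : act g @` N = act g^-1%g @^-1` N.
Proof.
apply/seteqP; split=> [_ [x Nx <-]|x Nx] /=; first by rewrite actK.
by exists (act g^-1%g x) => //; exact: actKV.
Qed.

Lemma act_image_closed g N : closed N -> closed (act g @` N).
Proof. by rewrite act_image; apply: (continuous_closedP _).1; exact: act_continuous. Qed.

Definition stable H N := forall h x, H h -> N x -> N (act h x).

Definition subgroup H := [/\ H 1%g, forall g h, H g -> H h -> H (g * h)%g &
  forall g, H g -> H g^-1%g].

Definition minimal_for H M := [/\ M !=set0, closed M, stable H M &
  forall N, N !=set0 -> closed N -> stable H N -> N `<=` M -> N = M].

Lemma minimal_set_for M : minimal_set act M -> minimal_for setT M.
Proof.
move=> [M0 cM iM minM]; split=> //; first by move=> h x _ Mx; rewrite -(iM h); exists x.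
move=> N N0 cN sN NM; apply: minM => // g; apply/seteqP; split.
  by move=> _ [x Nx <-]; exact: sN.
by move=> x Nx; exists (act g^-1%g x); [exact: sN|exact: actKV].
Qed.

Lemma minimal_dense H M x y (U : set X) : subgroup H -> minimal_for H M ->
  M x -> M y -> open U -> U y -> exists2 h, H h & U (act h x).
Proof.
move=> [H1 HM HV] [M0 cM sM minM] Mx My oU Uy.
pose O := [set act h x | h in H].
have OM : O `<=` M by move=> _ [h Hh <-]; exact: sM.
suff E : closure O = M.
  have : closure O y by rewrite E.
  by move=> /(_ U (open_nbhs_nbhs (conj oU Uy)))[_ [[h Hh <-] Uh]]; exists h.
apply: minM.
- by exists (act 1%g x); apply: subset_closure; exists 1%g.
- exact: closed_closure.
- move=> h z Hh Oz U' nU'.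
  have /Oz[_ [[k Hk <-] Uk]] : nbhs z (act h @^-1` U') by exact: act_continuous.
  exists (act (h * k)%g x); split; first by exists (h * k)%g => //; exact: HM.
  by have [_ _ ->] := gact.
- by rewrite (closure_id M).1//; exact: closureS.
Qed.

(** Zorn's lemma, applied to the complements. *)
Lemma exists_minimal H M : compact [set: X] -> M !=set0 -> closed M -> stable H M ->
  exists2 N, N `<=` M & minimal_for H N.
Proof.
move=> kX [x0 Mx0] cM sM.
have kM : compact M by apply: (subclosed_compact cM kX).
pose P (U : set X) := [/\ open U, stable H (~` U) & ~ (M `<=` U)].
have [|U [[oU sU nMU] Umax]] := @Zorn_bigcup _ P.
  move=> F FP tF; split.
  - by apply: bigcup_open => U /FP[].
  - move=> h x Hh nUx [U FU Uhx]; have [_ sU _] := FP U FU.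
    by apply: (sU h x Hh) => // Ux; apply: nUx; exists U.
  - move=> MF; have [||s [sF sP]] := compact_seq_cover (D := F) (f := id) kM.
    + by move=> U /FP[].
    + by move=> x /MF.
    + have [U0 U0s _] := sP x0 Mx0.
      have [B FB BP] := chain_seq_max tF (sF _ U0s) sF.
      have [_ _] := FP B FB; apply => x Mx.
      by have [U Us Ux] := sP x Mx; exact: BP Ux.
exists (M `&` ~` U); first by move=> x [].
split.
- by apply: contrapT => h; apply: nMU => x Mx; apply: contrapT => nUx; apply: h; exists x.
- by apply: closedI => //; exact: open_closedC.
- by move=> h x Hh [Mx Ux]; split; [exact: sM|exact: sU].
- move=> N [y Ny] cN sN NMU; apply/seteqP; split=> // x [Mx nUx].
  apply: contrapT => nNx; apply: (Umax (~` N)).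
    split; first by move=> z Uz Nz; have [_] := NMU z Nz.
    by move=> /(_ x nNx).
  split; [exact: closed_openC|by rewrite setCK|].
  by move=> /(_ y); apply => //; have [] := NMU y Ny.
Qed.

Lemma minimal_subset H M N : minimal_for H M -> closed N -> stable H N ->
  M `&` N !=set0 -> M `<=` N.
Proof.
move=> [M0 cM sM minM] cN sN MN.
suff <- : M `&` N = M by move=> x [].
apply: minM; [exact: MN|exact: closedI| |by move=> x []].
by move=> h x Hh [Mx Nx]; split; [exact: sM|exact: sN].
Qed.

(** If a cuts off b, then by minimality every point of M is cut off by a
    translate of a; by compactness finitely many points of M suffice to cut
    off all points of M, themselves included. A finite set has a minimal
    element for a strict order, so this is impossible. *)
Lemma minimal_no_cuts H M L a b : compact [set: X] -> connected [set: X] ->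
  locally_connected [set: X] -> subgroup H -> minimal_for H M ->
  L !=set0 -> stable H L -> M a -> M b -> ~ cuts L a b.
Proof.
move=> kX cX lcX sH mM L0 sL Ma Mb ab.
have c1 := @closed_set1 R X.
have [H1 HM HV] := sH; have [M0 cM sM minM] := mM.
have mov h x y : H h -> cuts L x y -> cuts L (act h x) (act h y).
  move=> Hh [yx yL]; split; first by move=> /act_inj.
  move=> z [K [Kx Ka cK] Kz] Lz; apply: (yL (act h^-1%g z)).
    exists (act h^-1%g @` K); last by exists z.
    split.
    - by exists (act h y) => //; exact: actK.
    - move=> _ [w Kw <-] /= E; apply: (Ka w Kw) => /=.
      by rewrite -E actKV.
    - apply: connected_continuous_connected => //.
      by apply: continuous_subspaceT; exact: act_continuous.
  by apply: sL => //; exact: HV.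
have [||s [sM' sP]] := compact_seq_cover (D := M) (f := fun a => [set b | cuts L a b])
    (subclosed_compact cM kX (@subsetT _ _)).
- by move=> x _; exact: cuts_open.
- move=> z Mz.
  have [h Hh az] := minimal_dense sH mM Mz Mb (cuts_open lcX c1 L a) ab.
  exists (act h^-1%g a); first by apply: sM => //; exact: HV.
  have Hv := HV h Hh; have := mov _ _ _ Hv az; by rewrite actK.
have [x xs _] := sP a Ma.
have [||m ms mP] := @seq_minimal _ (cuts L) s x _ _ xs.
- exact: cuts_irr.
- by move=> ? ? ?; exact: cuts_trans.
have [i is_ im] := sP m (sM' m ms).
exact: mP is_ im.
Qed.

(** Every orbit in M passes through the isolated point, so all points of M
    are isolated and M is finite by compactness. *)
Lemma minimal_isolated M x (U : set X) : compact [set: X] -> minimal_for setT M ->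
  M x -> open U -> U x -> (forall y, M y -> U y -> y = x) ->
  M = orbit_of act x /\ finite_set (orbit_of act x).
Proof.
move=> kX mM Mx oU Ux Uiso.
have [M0 cM sM minM] := mM.
have sT : subgroup setT by [].
have back z : M z -> exists g, act g z = x.
  move=> Mz; have [h _ Uh] := minimal_dense sT mM Mz Mx oU Ux.
  by exists h; apply: Uiso => //; exact: sM.
have ME : M = orbit_of act x.
  apply/seteqP; split=> [z Mz|_ [g _ <-]]; last exact: sM.
  by have [g gz] := back z Mz; exists g^-1%g => //; rewrite -gz actK.
split=> //; rewrite -ME.
have /choice[g gP] : forall z, exists g, M z -> act g z = x.
  move=> z; have [/back[g gz]|nM] := pselect (M z); first by exists g.
  by exists 1%g.
have [||s [sM' sP]] := compact_seq_cover (D := M) (f := fun z => act (g z) @^-1` U)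
    (subclosed_compact cM kX (@subsetT _ _)).
- by move=> z _; apply: open_comp => // y _; exact: act_continuous.
- by move=> z Mz; exists z => //=; rewrite gP.
apply: (sub_finite_set _ (finite_seq s)) => w Mw /=.
have [z zs Uz] := sP w Mw.
suff -> : w = z by [].
apply: (@act_inj (g z)); rewrite (gP z (sM' z zs)).
by apply: Uiso => //; exact: sM.
Qed.

End dynamics.

(** * Cantor sets *)

Section zero_dim.

(** In a compact Hausdorff space the intersection Q of the clopen sets
    containing x is connected. If Q were the union of two disjoint closed
    sets, normality and compactness would give a clopen neighbourhood of x
    split in the same way into two clopen sets, one of which contains Q. *)
Lemma compact_zero_dimensional (R : realType) (T : topologicalType) :
  hausdorff_space T -> compact [set: T] ->
  (forall (K : set T) x y, connected K -> K x -> K y -> x = y) ->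
  zero_dimensional T.
Proof.
move=> hT kT td x y xy; apply: contrapT => noU.
have inU (U : set T) : clopen U -> U x -> U y.
  by move=> cU Ux; apply: contrapT => nUy; apply: noU; exists U.
pose Q := \bigcap_(U in [set U : set T | clopen U /\ U x]) U.
have cQ : closed Q by apply: closed_bigI => U [[_ ?]].
have Qx : Q x by move=> U [].
have Qy : Q y by move=> U [cU Ux]; exact: inU.
move/eqP: xy; apply; apply: (td Q) => // B B0 [C oC BC] [D cD BD].
have cB : closed B by rewrite BD; exact: closedI.
have cB' : closed (Q `&` ~` C) by apply: closedI => //; exact: open_closedC.
have BB' : B `&` (Q `&` ~` C) = set0.
  by rewrite BC; apply/seteqP; split=> // z [[_ ?] [_]].
have /(@normal_openP R) /(_ _ _ cB cB' BB') [V1 [V2 [oV1 oV2 BV1 BV2 V12]]] :=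
  compact_normal hT kT.
have QV z : Q z -> V1 z \/ V2 z.
  move=> Qz; have [Cz|nCz] := pselect (C z); first by left; apply: BV1; rewrite BC.
  by right; apply: BV2.
have kV : compact (~` (V1 `|` V2)).
  by apply: (subclosed_compact _ kT) => //; apply: open_closedC; exact: openU.
have [||s [sD sP]] := compact_seq_cover (D := [set U : set T | clopen U /\ ~ U x])
    (f := id) kV.
- by move=> U [[]].
- move=> z /= nV; have nQ : ~ Q z by move=> /QV.
  have /existsNP[U /not_implyP[[cU Ux] nUz]] := nQ.
  by exists (~` U) => //; split; [exact: clopenC|].
have [U [cU Ux UP]] : exists U : set T, [/\ clopen U, U x &
    forall B, B \in s -> U `&` B = set0].
  elim: s sD {sP} => [|B' s IH] sD; first by exists setT; split=> //; exact: clopenT.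
  have [|U [cU Ux UP]] := IH; first by move=> Z Zs; apply: sD; rewrite inE Zs orbT.
  have [cB0 nBx] : clopen B' /\ ~ B' x by apply: sD; rewrite inE eqxx.
  exists (U `&` ~` B'); split; [|by split|].
    by apply: clopenI => //; exact: clopenC.
  move=> Z; rewrite inE => /predU1P[->|/UP UZ].
    by rewrite -setIA setICl setI0.
  by rewrite setIAC UZ set0I.
have UV z : U z -> V1 z \/ V2 z.
  move=> Uz; apply: contrapT => nV; have [B' B's Bz] := sP z nV.
  by have := UP B' B's; rewrite -subset0 => /(_ z); apply.
have dis z : V1 z -> V2 z -> False.
  by move=> h1 h2; have : (V1 `&` V2) z by []; rewrite V12.
have cl12 : clopen (U `&` V1).
  split; first by apply: openI => //; case: cU.
  have -> : U `&` V1 = U `&` ~` V2.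
    apply/seteqP; split=> z [Uz Vz]; split=> //; first by move/(dis z Vz).
    by case: (UV z Uz).
  by apply: closedI; [case: cU|exact: open_closedC].
have cl21 : clopen (U `&` V2).
  split; first by apply: openI => //; case: cU.
  have -> : U `&` V2 = U `&` ~` V1.
    apply/seteqP; split=> z [Uz Vz]; split=> //; first by move=> h; apply: (dis z h Vz).
    by case: (UV z Uz).
  by apply: closedI; [case: cU|exact: open_closedC].
have [V1x|V2x] := UV x Ux.
  apply/seteqP; split=> z; first by rewrite BC => -[].
  move=> Qz; rewrite BC; split=> //; apply: contrapT => nCz.
  have [_ V1z] : (U `&` V1) z by apply: Qz.
  by apply: (dis z V1z); apply: BV2.
have [z Bz] := B0.
have Qz : Q z by move: Bz; rewrite BC => -[].
have [_ V2z] : (U `&` V2) z by apply: Qz.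
by case: (dis z (BV1 _ Bz) V2z).
Qed.

Lemma set_type_compact (T : topologicalType) (M : set T) :
  compact M -> compact [set: M].
Proof.
move=> kM F PF _.
have [|p [Mp cp]] := kM ((\val : M -> T) @ F) _.
  by apply: (@filterE _ F) => m /=; exact: set_valP.
exists (exist _ p (mem_set Mp)); split=> // A B FA [C [[D oD <-] Dp CB]].
have [|q [[m Am mq] Dq]] := cp (\val @` A) D _ (open_nbhs_nbhs (conj oD Dp)).
  by apply: (@filterS _ F _ A) => // m Am; exists m.
exists m; split=> //; apply: CB.
have Dm : D (\val m) by rewrite mq.
exact: Dm.
Qed.

Lemma set_type_hausdorff (T : topologicalType) (M : set T) :
  hausdorff_space T -> hausdorff_space M.
Proof.
move=> hT p q pq; apply: val_inj; apply: hT => A B nA nB.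
have [r [Ar Br]] : (\val @^-1` A : set M) `&` (\val @^-1` B) !=set0.
  by apply: pq; apply: initial_continuous.
by exists (\val r).
Qed.

Lemma set_type_connected (T : topologicalType) (M : set T) (K : set M) :
  connected K -> connected (\val @` K).
Proof.
move=> cK; apply: connected_continuous_connected => //.
by apply: continuous_subspaceT; exact: initial_continuous.
Qed.

(** Brouwer's characterisation of the Cantor set, for compact subsets of a
    metric space. *)
Lemma cantor_setP (R : realType) (X : metricType R) (M : set X) :
  M !=set0 -> compact M ->
  (forall x U, M x -> nbhs x U -> exists y, [/\ M y, U y & y <> x]) ->
  (forall K x y, K `<=` M -> connected K -> K x -> K y -> x = y) ->
  is_cantor_set M.
Proof.
move=> [x0 Mx0] kM pM tM.
pose m0 : M := exist _ x0 (mem_set Mx0).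
pose T : pseudoPMetricType R := HB.pack (set_type M) (isPointed.Build (set_type M) m0).
have hX := @metric_hausdorff _ X.
have cT : cantor_like T.
  split.
  - apply/perfectTP => x [U oU Ux].
    have nU : nbhs (\val x) U.
      apply: open_nbhs_nbhs; split=> //.
      by have : [set x] x by []; rewrite -Ux.
    have [y [My Uy yx]] := pM _ _ (set_valP x) nU.
    apply: yx; pose y' : M := exist _ y (mem_set My).
    have : (\val @^-1` U) y' by [].
    by rewrite Ux => /= <-.
  - exact: set_type_compact.
  - exact: set_type_hausdorff.
  - apply: (@compact_zero_dimensional R).
    + exact: set_type_hausdorff.
    + exact: set_type_compact.
    + move=> K x y cK Kx Ky; apply: val_inj; apply: (tM (\val @` K)).
      * by move=> _ [z _ <-]; exact: set_valP.
      * exact: set_type_connected.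
      * by exists x.
      * by exists y.
have [f [cf clf]] := @homeomorphism_cantor_like R T cT.
exists (f^-1)%FUN, f; split.
- apply/continuous_closedP => D cD.
  suff -> : (f^-1)%FUN @^-1` D = f @` D by exact: clf.
  apply/seteqP; split=> z /=.
    by move=> Dz; exists (f^-1 z)%FUN => //; rewrite invK ?mem_set.
  by move=> [t Dt <-]; rewrite funK ?mem_set.
- exact: cf.
- by move=> z; rewrite invK ?mem_set.
- by move=> z; rewrite funK ?mem_set.
Qed.

End zero_dim.

(** * Minimal sets in local dendrites *)

Lemma homeomorphic_trans (S T U : topologicalType) :
  homeomorphic S T -> homeomorphic T U -> homeomorphic S U.
Proof.
move=> [f [g [cf cg fg gf]]] [f' [g' [cf' cg' fg' gf']]].
exists (f' \o f), (g \o g'); split.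
- by move=> x; apply: continuous_comp; [exact: cf|exact: cf'].
- by move=> x; apply: continuous_comp; [exact: cg'|exact: cg].
- exact: can_comp.
- exact: can_comp.
Qed.

Section main.
Context {R : realType} {X : metricType R} {G : groupType} (act : G -> X -> X).
Hypothesis gact : is_group_action act.
Hypotheses (kX : compact [set: X]) (cX : connected [set: X]).
Hypothesis lcX : locally_connected [set: X].
Hypothesis finC : finite_set [set C : set X | is_circle R C].
Implicit Types (C K M N : set X).

Let actM g h N : act (g * h)%g @` N = act g @` (act h @` N).
Proof.
have [_ _ aM] := gact; rewrite image_comp.
by apply: eq_imagel => x _; rewrite aM.
Qed.

Let act1 N : act 1%g @` N = N.
Proof.
have [_ a1 _] := gact; rewrite -[RHS]image_id.
by apply: eq_imagel => x _; rewrite a1.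
Qed.

Lemma act_circle g C : is_circle R C -> is_circle R (act g @` C).
Proof.
move=> cC; apply: (homeomorphic_trans _ cC).
apply: homeomorphic_image.
- exact: (subclosed_compact (circle_closed cC) kX (@subsetT _ _)).
- exact: metric_hausdorff.
- exact: metric_hausdorff.
- by apply: continuous_subspaceT; exact: act_continuous.
- by move=> x y _ _; exact: act_inj.
Qed.

(** The kernel of the action of the group on the finite set of circles: a
    normal subgroup of finite index. *)
Definition circle_stab : set G := [set g | forall C, is_circle R C -> act g @` C = C].

Lemma circle_stab_subgroup : subgroup circle_stab.
Proof.
split=> [C _|g h Hg Hh C cC|g Hg C cC].
- exact: act1.
- by rewrite actM Hh// Hg.
- by rewrite -{1}(Hg C cC) -actM mulVg act1.
Qed.

Lemma circle_stab_stable C : is_circle R C -> stable act circle_stab C.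
Proof. by move=> cC h x Hh Cx; rewrite -(Hh C cC); exists x. Qed.

Lemma circle_stab_conj g h : circle_stab h -> circle_stab (g^-1 * (h * g))%g.
Proof.
move=> Hh C cC; rewrite !actM Hh; last exact: act_circle.
by rewrite -actM mulVg act1.
Qed.

(** This is where normality of the subgroup is used. *)
Lemma minimal_translate g N : minimal_for act circle_stab N ->
  minimal_for act circle_stab (act g @` N).
Proof.
move=> [N0 cN sN minN]; split.
- by case: N0 => x Nx; exists (act g x), x.
- exact: act_image_closed.
- move=> h _ Hh [x Nx <-]; exists (act (g^-1 * (h * g))%g x).
    by apply: sN => //; exact: circle_stab_conj.
  by have [_ _ aM] := gact; rewrite !aM actKV.
- move=> M M0 cM sM MN.
  have E : act g^-1%g @` M = N.
    apply: minN.
    + by case: M0 => x Mx; exists (act g^-1%g x), x.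
    + exact: act_image_closed.
    + move=> h _ Hh [x Mx <-]; exists (act (g * (h * g^-1))%g x).
        by apply: sM => //; have := circle_stab_conj g^-1%g Hh; rewrite invgK.
      by have [_ _ aM] := gact; rewrite !aM actK.
    + by move=> _ [x /MN[y Ny <-] <-]; rewrite actK.
  by rewrite -E -actM mulgV act1.
Qed.

(** Two group elements that permute the circles in the same way differ by
    an element of the subgroup, which preserves N. *)
Lemma finite_translates N : minimal_for act circle_stab N ->
  finite_set [set act g @` N | g in [set: G]].
Proof.
move=> [N0 cN sN minN].
have [s sE] := (finite_seqP _).1 finC.
have inC C : is_circle R C -> C \in s.
  by move=> cC; have : [set C : set X | is_circle R C] C by []; rewrite sE.
have sC C : C \in s -> is_circle R C.
  by move=> Cs; have : [set` s] C by []; rewrite -sE.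
have [x0 Nx0] := N0.
pose n := size s.
have /choice[sig sigP] : forall g, exists sig : {ffun 'I_n -> 'I_n},
    forall i : 'I_n, act g @` (nth set0 s i) = nth set0 s (sig i).
  move=> g; have /choice[f fP] : forall i : 'I_n, exists j : 'I_n,
      act g @` (nth set0 s i) = nth set0 s j.
    move=> i; have /inC js := act_circle g (sC _ (mem_nth set0 (ltn_ord i))).
    rewrite -index_mem in js.
    by exists (Ordinal js); rewrite /= nth_index// -index_mem.
  by exists [ffun i => f i] => i; rewrite ffunE.
have /choice[tau tauP] : forall f : {ffun 'I_n -> 'I_n}, exists g : G,
    (exists g', sig g' = f) -> sig g = f.
  by move=> f; have [[g gf]|no] := pselect (exists g, sig g = f); [exists g|exists 1%g].
apply: (@sub_finite_set _ _ [set act (tau f) @` N | f in [set: {ffun 'I_n -> 'I_n}]]).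
  move=> _ [g _ <-]; exists (sig g) => //.
  have E : sig (tau (sig g)) = sig g by apply: tauP; exists g.
  set g' := tau _ in E *.
  have Hk : circle_stab (g^-1 * g')%g.
    move=> C cC; have Cs := inC C cC; have Ci := Cs; rewrite -index_mem in Ci.
    have CE : C = nth set0 s (Ordinal Ci) by rewrite /= nth_index.
    by rewrite actM {1}CE sigP E -sigP -CE -actM mulVg act1.
  have kN : act (g^-1 * g')%g @` N = N.
    have [_ _ HV] := circle_stab_subgroup.
    apply/seteqP; split; first by move=> _ [x Nx <-]; exact: sN.
    move=> x Nx; exists (act (g^-1 * g')^-1%g x); last exact: actKV.
    by apply: sN => //; exact: HV.
  by rewrite -[in RHS]kN -actM mulgA mulgV mul1g.
apply: finite_image; exact: finite_finset.
Qed.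

(** M is the union of finitely many translates of a minimal set of the
    subgroup. They are closed, and equal or disjoint by minimality, so the
    connected set K lies in one of them. *)
Lemma minimal_reduction M K x y : minimal_for act setT M ->
  K `<=` M -> connected K -> K x -> K y -> x <> y ->
  exists N, [/\ minimal_for act circle_stab N, K `<=` N &
    M = \bigcup_(g in [set: G]) (act g @` N)].
Proof.
move=> mM KM cK Kx Ky xy.
have [M0 cM sM minM] := mM.
have [|N0 N0M mN0] := @exists_minimal _ _ _ act circle_stab M kX M0 cM.
  by move=> h z _; exact: sM.
have fin := finite_translates mN0.
set F := [set act g @` N0 | g in [set: G]] in fin.
have FP N : F N -> minimal_for act circle_stab N.
  by move=> [g _ <-]; exact: minimal_translate.
have ME : \bigcup_(N in F) N = M.
  apply: minM.
  - by have [[z Nz] _ _ _] := mN0; exists (act 1%g z), (act 1%g @` N0);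
      [exists 1%g|exists z].
  - apply: closed_bigcup => // N /FP[] //.
  - move=> h _ _ [_ [g _ <-] [z Nz <-]]; exists (act (h * g)%g @` N0).
      by exists (h * g)%g.
    by have [_ _ aM] := gact; exists z => //; rewrite aM.
  - by move=> _ [_ [g _ <-] [z Nz <-]]; apply: sM => //; exact: N0M.
have : M x by exact: KM.
rewrite -ME => -[N FN Nx].
have dis N' z : F N' -> N z -> N' z -> N' = N.
  move=> FN' Nz N'z; have [_ cN sN _] := FP N FN; have [_ cN' sN' _] := FP N' FN'.
  apply/seteqP; split; apply: minimal_subset.
  - exact: FP N' FN'.
  - exact: cN.
  - exact: sN.
  - by exists z.
  - exact: FP N FN.
  - exact: cN'.
  - exact: sN'.
  - by exists z.
exists N; split; first exact: FP.
- suff E : K `&` N = K by rewrite -E => z [].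
  apply: cK; first by exists x.
    exists (~` \bigcup_(N' in F `&` [set N' | N' <> N]) N').
      apply: closed_openC; apply: closed_bigcup.
        by apply: sub_finite_set fin => N' [].
      by move=> N' [/FP[]].
    apply/seteqP; split=> z [Kz].
      move=> Nz; split=> // -[N' [FN' N'N] N'z].
      by apply: N'N; exact: dis FN' Nz N'z.
    move=> nz; split=> //; have : M z by exact: KM.
    rewrite -ME => -[N' FN' N'z].
    have [<-//|NN] := pselect (N' = N).
    by case: nz; exists N'.
  by exists N; [have [] := FP N FN|].
- have [g _ gN] := FN; apply/seteqP; split.
    move=> z [_ [h _ <-] hz]; exists (h * g^-1)%g => //.
    by rewrite -gN -actM -mulgA mulVg mulg1.
  move=> z [h _ hz]; exists (act h @` N) => //.
  by exists (h * g)%g => //; rewrite actM gN.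
Qed.

(** N contains an arc of C, so it has interior points relative to C. By
    minimality all its points are such; thus N is open and closed in C. *)
Lemma minimal_in_circle N C K x y : minimal_for act circle_stab N ->
  is_circle R C -> N `&` C !=set0 -> K `<=` N -> connected K -> K x -> K y ->
  x <> y -> N = C.
Proof.
move=> mN cC NC KN cK Kx Ky xy.
have NsC : N `<=` C.
  exact: minimal_subset mN (circle_closed cC) (circle_stab_stable cC) NC.
have [N0 cN sN minN] := mN.
have [_ _ HV] := circle_stab_subgroup.
have [A [B [aA aB AB AIB]]] := circle_split cC (NsC _ (KN _ Kx)) (NsC _ (KN _ Ky)) xy.
pose I := \bigcup_(V in [set V | open V /\ C `&` V `<=` N]) V.
have oI : open I by apply: bigcup_open => V [].
have [i Ni Ii] : exists2 i, N i & I i.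
  wlog AK : A B aA aB AB AIB / A `<=` K.
    move=> W; have [|AK|BK] := connected_sub_circle aA aB AIB cK _ Kx Ky.
    - by rewrite AB; exact: subset_trans NsC.
    - exact: (W A B).
    - by apply: (W B A) => //; [rewrite setUC|rewrite setIC].
  have [a [Aa ax ay]] := arc_inner aA.
  exists a; first by apply: KN; exact: AK.
  exists (~` B).
    split; first by apply: closed_openC; exact: arc_closed aB.
    move=> z [Cz nBz]; apply: KN; apply: AK.
    by move: Cz; rewrite -AB => -[//|/nBz].
  move=> Ba; have : (A `&` B) a by []. 
  by rewrite AIB => -[].
have IN : N `<=` I.
  move=> z Nz; apply: contrapT => nIz.
  suff E : N `&` ~` I = N by have : N i by []; rewrite -E => -[].
  apply: minN.
  - by exists z.
  - by apply: closedI => //; exact: open_closedC.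
  - move=> h w Hh [Nw nIw]; split; first exact: sN.
    move=> [V [oV VN] Vhw]; apply: nIw; exists (act h @^-1` V) => //; split.
      by apply: open_comp => // u _; exact: act_continuous.
    move=> u [Cu Vu]; rewrite -(actK gact h u); apply: sN; first exact: HV.
    by apply: VN; split=> //; exact: circle_stab_stable.
  - by move=> w [].
apply: (circle_connected cC) => //.
- exists I => //; apply/seteqP; split=> z; first by move=> Nz; split; [exact: NsC|exact: IN].
  by move=> [Cz [V [oV VN] Vz]]; exact: VN.
- by exists N => //; apply/seteqP; split=> z; [move=> Nz; split=> //; exact: NsC|move=> []].
Qed.

(** Circles that meet C are equal to C by minimality, so C' is disjoint
    from C; let W be the component of the complement of C that contains C'.
    The set of points of C that are limits of W is closed, invariant and, X
    being connected, nonempty, hence all of C. So two points p and q of C can be joined through W and small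
    neighbourhoods of p and q. This yields a circle that meets C, in a point a
    between p and q, without containing C, which is absurd. *)
Lemma minimal_circle_unique C C' : minimal_for act circle_stab C ->
  is_circle R C -> is_circle R C' -> C' = C.
Proof.
move=> mC cC cC'.
have [C0 clC sC minC] := mC.
have c1 := @closed_set1 R X.
have meet D : is_circle R D -> C `&` D !=set0 -> C = D.
  move=> cD CD; apply: circle_sub_circle => //.
  exact: minimal_subset mC (circle_closed cD) (circle_stab_stable cD) CD.
have [/meet->//|dis] := pselect (C `&` C' !=set0).
have dis' z : C' z -> ~ C z by move=> C'z Cz; apply: dis; exists z.
have [w [_ [C'w _ _]]] := circle_two_points cC'.
pose W := connected_component (~` C) w.
have oW : open W by apply: component_open_setT => //; exact: closed_openC.
have Ww : W w by apply: connected_component_refl; exact: dis'.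
have cW : connected W by exact: component_connected.
have WC z : W z -> ~ C z by exact: connected_component_sub.
have C'W : C' `<=` W.
  by move=> z C'z; exists C' => //; split=> //; exact: circle_connected.
have CclW : C `<=` closure W.
  apply: (minimal_subset mC (@closed_closure _ W)).
    move=> h z Hh Wz.
    have sW v : W v -> W (act h v).
      move=> [Q [Qw QC cQ] Qv]; apply: (@connected_component_trans _ _ (act h w)).
        by apply: C'W; exact: circle_stab_stable.
      exists (act h @` Q); last by exists v.
      split; first by exists w.
      - move=> _ [u Qu <-] Chu; apply: (QC u Qu).
        have [_ _ HV] := circle_stab_subgroup.
        by rewrite -(actK gact h u); apply: sC => //; exact: HV.
      - apply: connected_continuous_connected => //.
        by apply: continuous_subspaceT; exact: act_continuous.
    move=> U nU; have /Wz[v [Wv Uv]] : nbhs z (act h @^-1` U) by exact: act_continuous.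
    by exists (act h v); split=> //; exact: sW.
  apply: contrapT => noC.
  have clW : closed W.
    move=> z Wz; have nCz : ~ C z by move=> Cz; apply: noC; exists z.
    have oZ : open (connected_component (~` C) z).
      by apply: component_open_setT => //; exact: closed_openC.
    have Zz : connected_component (~` C) z z by exact: connected_component_refl.
    have [v [Wv Zv]] := Wz _ (open_nbhs_nbhs (conj oZ Zz)).
    by apply: (connected_component_trans Wv); exact: connected_component_sym.
  have WT := clopen_setT cX oW clW Ww.
  have [c Cc] := C0; apply: (WC c) => //; by rewrite WT.
have [p [q [Cp Cq pq]]] := circle_two_points cC.
have [A [B [aA aB AB AIB]]] := circle_split cC Cp Cq pq.
have [a [Aa ap aq]] := arc_inner aA.
have [b [Bb bp bq]] := arc_inner aB.
have small z : a <> z -> b <> z -> exists V, [/\ open V, V z, connected V, ~ V a & ~ V b].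
  move=> az bz.
  have oab : open (~` [set a] `&` ~` [set b]).
    by apply: openI; apply: closed_openC; exact: c1.
  have zab : (~` [set a] `&` ~` [set b]) z by split; exact: nesym.
  have [V [oV Vz Vab]] := lcX (x := z) I (open_nbhs_nbhs (conj oab zab)).
  rewrite setIT in Vab * => cV; exists V; split=> //.
    by move=> /Vab[/(_ erefl)].
  by move=> /Vab[_ /(_ erefl)].
have [V1 [oV1 V1p cV1 V1a V1b]] := small p ap bp.
have [V2 [oV2 V2q cV2 V2a V2b]] := small q aq bq.
pose O := (V1 `|` W) `|` V2.
have oO : open O by apply: openU => //; apply: openU.
have cO : connected O.
  apply: connectedU => //.
    have [v [Wv Vv]] := CclW q Cq V2 (open_nbhs_nbhs (conj oV2 V2q)).
    by exists v; split=> //; right.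
  apply: connectedU => //.
  have [v [Wv Vv]] := CclW p Cp V1 (open_nbhs_nbhs (conj oV1 V1p)).
  by exists v.
have Ca : C a by rewrite -AB; left.
have Cb : C b by rewrite -AB; right.
have nOa : ~ O a by move=> [[//|/WC/(_ Ca)]|].
have nOb : ~ O b by move=> [[//|/WC/(_ Cb)]|].
have [||||D [cD Da DAO]] := @circle_through _ _ [set: X] O A p q a kX lcX oO _ _ _ aA Aa ap aq.
- by rewrite setTI.
- by split=> //; left; left.
- by split=> //; right.
- by rewrite setTI.
have DC : C = D by apply: meet => //; exists a.
have : D b by rewrite -DC.
move=> /DAO[Ab|[_ //]].
have : (A `&` B) b by [].
by rewrite AIB => -[].
Qed.

(** Suppose that N misses all circles. Two nearby points x and z of K are
    joined by an arc in an open set without points of circles, so each interior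
    point a of that arc separates x from z, hence lies in K. As the circle C0
    is connected and avoids a, it cannot be on the side of both x and z:
    one of them is cut off from C0 by a, contrary to minimality. *)
Lemma minimal_meets_circle N C0 K x y : minimal_for act circle_stab N ->
  is_circle R C0 -> K `<=` N -> connected K -> K x -> K y -> x <> y ->
  exists2 C, is_circle R C & N `&` C !=set0.
Proof.
move=> mN cC0 KN cK Kx Ky xy; apply: contrapT => noC.
have miss C z : is_circle R C -> N z -> ~ C z.
  by move=> cC Nz Cz; apply: noC; exists C => //; exists z.
have c1 := @closed_set1 R X.
pose Lc := \bigcup_(C in [set C : set X | is_circle R C]) C.
have cL : closed Lc by apply: closed_bigcup => // C; exact: circle_closed.
have xL : (~` Lc) x by move=> [C cC]; exact: miss (KN _ Kx).
have [V [oV Vx VL]] := lcX (x := x) I (open_nbhs_nbhs (conj (closed_openC cL) xL)).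
rewrite setIT in VL * => cV.
have [z [Kz Vz zx]] : exists z, [/\ K z, V z & z <> x].
  apply: contrapT => no; apply: xy.
  suff : [set x] = K by move=> E; move: Ky; rewrite -E => /= ->.
  apply: cK; first by exists x.
  - exists V => //; apply/seteqP; split=> [_ ->//|v [Kv Vv]].
    by apply: contrapT => vx; apply: no; exists v.
  - by exists [set x] => //; apply/seteqP; split=> [_ ->//|v []].
have [A aA AV] : exists2 A, is_arc x z A & A `<=` [set: X] `&` V.
  apply: arc_in_open => //; rewrite ?setTI//; exact: nesym.
have [a [Aa ax az]] := arc_inner aA.
have Va : V a by have [] := AV _ Aa.
have nsep : ~ connected_component (~` [set a]) x z.
  rewrite -setTD => cxz.
  have [|C [cC Ca _]] := circle_of_nonseparating kX lcX aA _ Aa ax az cxz => //.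
  by apply: (VL a Va); exists C.
have Ka : K a.
  apply: contrapT => nKa; apply: nsep; exists K => //; split=> // v Kv /= va.
  by rewrite -va in nKa.
have nC0a : ~ C0 a by apply: miss => //; exact: KN.
have [c [_ [C0c _ _]]] := circle_two_points cC0.
have L0 : C0 !=set0 by exists c.
have nocut v : K v -> ~ cuts C0 a v.
  move=> Kv; apply: (minimal_no_cuts gact kX cX lcX circle_stab_subgroup mN L0).
  - exact: circle_stab_stable.
  - exact: KN.
  - exact: KN.
have toc v : K v -> a <> v -> connected_component (~` [set a]) v c.
  move=> Kv av; apply: contrapT => nc; apply: (nocut v Kv); split; first exact: nesym.
  move=> u vu C0u; apply: nc; apply: (connected_component_trans vu).
  exists C0 => //; split=> //; last exact: circle_connected.
  by move=> t C0t /= ta; apply: nC0a; rewrite -ta.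
apply: nsep; apply: (connected_component_trans (toc x Kx ax)).
by apply: connected_component_sym; exact: toc.
Qed.

End main.

Theorem theorem3p9 (R : realType) (X : metricType R) (G : groupType)
    (act : G -> X -> X) (M : set X) :
  local_dendrite X -> ~ dendrite [set: X] ->
  is_group_action act -> minimal_set act M ->
  (exists x : X, M = orbit_of act x /\ finite_set (orbit_of act x)) \/
  is_cantor_set M \/
  is_circle R M.
Proof.
move=> ldX ndX gact /(minimal_set_for gact) mM.
have [[kX cX] _] := ldX.
have lcX := local_dendrite_lc ldX.
have finC := finite_circles ldX.
have [C0 cC0] : exists C0 : set X, is_circle R C0.
  apply: contrapT => no; apply: ndX; split=> // -[C _ cC].
  by apply: no; exists C.
have [M0 cM sM minM] := mM.
have kM : compact M := subclosed_compact cM kX (@subsetT _ _).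
have [[x [U [Mx nU Uiso]]]|noiso] := pselect (exists x U,
    [/\ M x, nbhs x U & forall y, M y -> U y -> y = x]).
  left; exists x; move: nU; rewrite nbhsE => -[V [oV Vx] VU].
  apply: (minimal_isolated gact kX mM Mx oV Vx) => y My Vy.
  by apply: Uiso => //; exact: VU.
right.
have [[K [x [y [KM cK Kx Ky xy]]]]|td] := pselect (exists K x y,
    [/\ K `<=` M, connected K, K x, K y & x <> y]); last first.
  left; apply: cantor_setP => //.
    move=> x U Mx nU; apply: contrapT => no; apply: noiso; exists x, U; split=> // y My Uy.
    by apply: contrapT => yx; apply: no; exists y.
  move=> K x y KM cK Kx Ky; apply: contrapT => xy; apply: td.
  by exists K, x, y.
right.
have [N [mN KN ME]] := minimal_reduction gact kX finC mM KM cK Kx Ky xy.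
have [C cC NC] := minimal_meets_circle gact kX cX lcX finC mN cC0 KN cK Kx Ky xy.
have NE := minimal_in_circle gact mN cC NC KN cK Kx Ky xy.
rewrite {}NE in mN ME.
suff -> : M = C by [].
rewrite ME; apply/seteqP; split=> z.
  move=> [g _]; have cgC := act_circle gact kX g cC.
  by rewrite (minimal_circle_unique gact kX cX lcX mN cC cgC).
by move=> Cz; exists 1%g => //; exists z => //; have [_ ->] := gact.
Qed.
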